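(* Let $k$ be a field of characteristic zero, $B=k[x,y,z]$, $K=k(x)$, and let $D$ be an irreducible locally nilpotent derivation of $B$ of rank $2$ with $D(x)=0$. Let $\alpha\in\Psi(D)$. Then $\mathrm{ulev}(D)=c(\alpha)+2$.
   Context: $D$ extends to a $K$-linear LND $\tilde D$ of $K[y,z]$. $\Psi(D)$ is the set of $K$-automorphisms $\alpha$ of $K[y,z]$ such that $K[y,z]=K[\alpha(y),\alpha(z)]$, $\alpha(y)$ generates $\mathrm{Ker}\,\tilde D$ over $K$ and $\tilde D(\alpha(z))\in K^*$. Automorphisms are written $\beta=(\beta(y),\beta(z))$ and composed by $\beta\circ\alpha=(\beta(y)(\alpha(y),\alpha(z)),\ \beta(z)(\alpha(y),\alpha(z)))$. $\mathrm{T}_2(K)$ is the group of automorphisms $(ay+b,\ cz+p(y))$ with $a,c\in K^*$, $b\in K$, $p\in K[t]$; $\theta=(z,y)$ is the swap. The complexity $c(\alpha)$ is the minimal $m\ge0$ such that there are $\tau_0,\dots,\tau_m\in\mathrm{T}_2(K)$ for which $\varphi=\tau_m\circ\theta\circ\tau_{m-1}\circ\cdots\circ\theta\circ\tau_0\circ\alpha$ (with $m$ swaps) satisfies $\varphi(y),\varphi(z)\in k[x,y,z]$ and $k[x,\varphi(y),\varphi(z)]=k[x,y,z]$. Universal level: for a coordinate system $\mathbf y=(y_1,y_2,y_3)$ of $B$ with $D(y_3)=0$, a full irreducible MC-chain ending at $D$ is a sequence of irreducible LNDs $\partial_1=\partial/\partial y_1,\partial_2=\partial/\partial y_2,\dots,\partial_l=D$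 all vanishing on $y_3$, with $h_i\partial_i=\sigma\partial_{i-1}+f_i\partial_{i-2}$ for $3\le i\le l$, some $\sigma\in\mathrm{Ker}\,\partial_{i-1}$, $f_i,h_i\in k[y_3]\setminus\{0\}$; $\mathrm{lev}_{\mathbf y}(D)$ is the minimal such $l$, and $\mathrm{ulev}(D)$ is the minimum of $\mathrm{lev}_{\mathbf y}(D)$ over all coordinate systems $\mathbf y$ with $D(y_3)=0$. Irreducible: image not in a proper principal ideal; rank: least $i$ with a coordinate system $(x_1,x_2,x_3)$ having $k[x_{i+1},\dots,x_3]\subseteq\mathrm{Ker}\,D$. *)

(* Defs.v *)
From HB Require Import structures.
From mathcomp Require Import all_boot all_order all_algebra.
From mathcomp Require Import mpoly.
Set Implicit Arguments. Unset Strict Implicit. Unset Printing Implicit Defensive.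
Import Order.TTheory GRing.Theory.
Local Open Scope ring_scope.

Section Generic.
Variables (R : fieldType) (n : nat).
Local Notation P := {mpoly R[n]}.

Definition is_derivation (d : P -> P) : Prop :=
  [/\ forall f g, d (f + g) = d f + d g,
      forall (c : R) f, d (c *: f) = c *: d f
    & forall f g, d (f * g) = f * d g + g * d f].

Definition locally_nilpotent (d : P -> P) : Prop :=
  forall f, exists m : nat, iter m d f = 0.

Definition is_LND (d : P -> P) : Prop := is_derivation d /\ locally_nilpotent d.

Definition mdvd (c f : P) : Prop := exists g, f = c * g.

Definition irreducible_der (d : P -> P) : Prop :=
  forall c : P, (forall f, mdvd c (d f)) -> exists a : R, a != 0 /\ c = a%:MP.

Definition subalg (t : n.-tuple P) (S : pred 'I_n) (f : P) : Prop :=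
  exists r : P, (forall m, m \in msupp r -> forall j, j \notin S -> m j = 0%N)
                /\ f = comp_mpoly t r.

Definition coord_system (t : n.-tuple P) : Prop :=
  forall f : P, exists r : P, f = comp_mpoly t r.

Definition is_partial (t : n.-tuple P) (j : 'I_n) (d : P -> P) : Prop :=
  is_derivation d /\ forall i : 'I_n, d (tnth t i) = (i == j)%:R.

End Generic.

Section Setting.
Variable k : fieldType.
Local Notation B := {mpoly k[3]}.

Definition i0 : 'I_3 := @Ordinal 3 0 isT.
Definition i1 : 'I_3 := @Ordinal 3 1 isT.
Definition i2 : 'I_3 := @Ordinal 3 2 isT.
Definition xB : B := 'X_i0.
Definition yB : B := 'X_i1.
Definition zB : B := 'X_i2.

(* rank: least i such that some coordinate system (x1,x2,x3) has
   k[x_{i+1},...,x_3] contained in Ker d  (0-indexed: entries j >= i) *)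
Definition rank_le (d : B -> B) (i : nat) : Prop :=
  exists t : 3.-tuple B, coord_system t /\
    forall f, subalg t (fun j : 'I_3 => (i <= j)%N) f -> d f = 0.

Definition has_rank (d : B -> B) (i : nat) : Prop :=
  rank_le d i /\ forall j, (j < i)%N -> ~ rank_le d j.

Definition full_irr_MC_chain (D : B -> B) (t : 3.-tuple B)
    (ds : nat -> B -> B) (l : nat) : Prop :=
  [/\ (1 <= l)%N,
      is_partial t i0 (ds 1%N),
      ((2 <= l)%N -> is_partial t i1 (ds 2%N)),
      (forall f, ds l f = D f)
    & (forall i, (1 <= i <= l)%N ->
         [/\ is_LND (ds i), irreducible_der (ds i) & ds i (tnth t i2) = 0])] /\
    (forall i, (3 <= i <= l)%N ->
         exists sigma f_i h_i : B,
           [/\ ds i.-1 sigma = 0,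
               subalg t (pred1 i2) f_i /\ f_i != 0,
               subalg t (pred1 i2) h_i /\ h_i != 0
             & forall g, h_i * ds i g = sigma * ds i.-1 g + f_i * ds i.-2 g]).

Definition has_chain_of_length (D : B -> B) (t : 3.-tuple B) (l : nat) : Prop :=
  exists ds, full_irr_MC_chain D t ds l.

Definition ulev_chain (D : B -> B) (l : nat) : Prop :=
  exists t : 3.-tuple B, [/\ coord_system t, D (tnth t i2) = 0
                           & has_chain_of_length D t l].

Definition has_ulev (D : B -> B) (n : nat) : Prop :=
  ulev_chain D n /\ forall l, (l < n)%N -> ~ ulev_chain D l.

Definition K := {fraction {poly k}}.
Local Notation KYZ := {mpoly K[2]}.

Definition j0 : 'I_2 := @Ordinal 2 0 isT.
Definition j1 : 'I_2 := @Ordinal 2 1 isT.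
Definition yK : KYZ := 'X_j0.
Definition zK : KYZ := 'X_j1.

Definition iota (f : B) : KYZ :=
  mmap (fun c : k => (FracField.tofrac (c%:P) : K)%:MP)
       (tnth [tuple (FracField.tofrac ('X : {poly k}) : K)%:MP; yK; zK]) f.

(* automorphisms of K[y,z] as pairs (beta(y), beta(z)) *)
Definition aut2 := 2.-tuple KYZ.
Definition acomp (beta alpha : aut2) : aut2 :=
  [tuple comp_mpoly alpha (tnth beta j0); comp_mpoly alpha (tnth beta j1)].
Definition theta : aut2 := [tuple zK; yK].

Definition in_T2 (tau : aut2) : Prop :=
  exists (a b c : K) (p : {poly K}), [/\ a != 0, c != 0 &
    tau = [tuple a *: yK + b%:MP; c *: zK + (map_poly (@mpolyC 2 K) p).[yK]]].

(* phi = tau_m o theta o tau_{m-1} o ... o theta o tau_0 o alpha,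
   where rest = [:: tau_1; ...; tau_m] *)
Definition chain_aut (alpha tau0 : aut2) (rest : seq aut2) : aut2 :=
  foldl (fun acc tau => acomp tau (acomp theta acc)) (acomp tau0 alpha) rest.

Definition good_phi (phi : aut2) : Prop :=
  exists f g : B, [/\ tnth phi j0 = iota f, tnth phi j1 = iota g
                    & coord_system [tuple xB; f; g]].

Definition complexity_le_witness (alpha : aut2) (m : nat) : Prop :=
  exists (tau0 : aut2) (rest : seq aut2),
    [/\ size rest = m, in_T2 tau0, (forall tau, tau \in rest -> in_T2 tau)
      & good_phi (chain_aut alpha tau0 rest)].

Definition has_complexity (alpha : aut2) (m : nat) : Prop :=
  complexity_le_witness alpha m /\
  forall m', (m' < m)%N -> ~ complexity_le_witness alpha m'.

Definition extends (D : B -> B) (Dt : KYZ -> KYZ) : Prop :=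
  is_derivation Dt /\ forall f, Dt (iota f) = iota (D f).

Definition in_Psi (Dt : KYZ -> KYZ) (alpha : aut2) : Prop :=
  [/\ coord_system alpha,
      (forall f, Dt f = 0 <-> subalg alpha (pred1 j0) f)
    & exists c : K, c != 0 /\ Dt (tnth alpha j1) = c%:MP].

End Setting.

(* Main.v *)
(* The lower bound: in a chain over [k[x]] with [h_i d_i = s_i d_{i-1} + f_i d_{i-2}],
   the kernel of the extension of [d_i] to [K[y,z]] is generated by
   [F_i = F_{i-2} - S_i(F_{i-1})] with [S_i'] proportional to [s_i = s_i(F_{i-1})].
   So [(F_i, F_{i-1})] is obtained from [(F_{i-1}, F_{i-2})] by one triangular map and
   one swap, and [(F_2, F_1)] is a coordinate system over [k[x]].  Read backwards, a
   decomposition of [alpha] produces the kernel generators of a chain; clearing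
   denominators and contents turns them into irreducible derivations of [B].

   A chain may a priori use another variable [y_3] of the kernel.  Its penultimate
   generator is a local slice, so some nonzero [g(y_3)] lies in the image of [D]; since
   [D] has rank 2, it has no slice, and [g(y_3)] is divisible by a nonconstant [p(x)],
   whence [k[y_3] = k[x]].

   That the complexity is finite at all is Jung's theorem.  If the leading monomials of
   the components of an automorphism [(F, G)] were [mu^p], [mu^q] with [p, q > 1]
   coprime, the degree of [H(F, G)] would be too large for it to be [y]: applying
   [Y d/dY - e] to [H] raises the degree of [H(F, G)] by at most [deg F + deg G - 2],
   and few such operators remove all cancellation. *)
Require Import Defs.
From HB Require Import structures.
From mathcomp Require Import all_boot all_order all_algebra.
From mathcomp Require Import mpoly.
From mathcomp Require Import vector falgebra fieldext.
From mathcomp Require Import ring zify.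
From Stdlib Require Import Classical.
Set Implicit Arguments. Unset Strict Implicit. Unset Printing Implicit Defensive.
Import Order.TTheory GRing.Theory.
Local Open Scope ring_scope.

(** * Polynomials, derivations and coordinate systems *)

(** The choice of [alpha] is immaterial: two coordinate pairs whose first component is killed by the
    same derivation of [K[y,z]] and whose second is sent to a nonzero constant differ by a
    triangular map, which [tau_0] absorbs. It is therefore enough to compare chains with
    decompositions of any such pair. The summand 2 counts the two partial derivatives with which a
    chain starts and to which a decomposition without swaps corresponds. The obstacle is that a
    chain lives over [k[y_3]], while the plane calculus needs [y_3] to be a constant of [K]. The
    calculus is therefore applied twice: to the chain transported by an automorphism taking [y_3] to
    [x], which yields only a local slice, and, once [x] is known to be affine in [y_3], to the chain
    itself. Divisibility by [p(x)] is tested by reduction to [(k[x]/p)[y,z]]; there the kernel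
    generator must stay nonconstant, which is why it is normalised to content one and no constant
    term. The field [K] appears as an abstract [L] with an injective [toK] from [k[x]] such that
    every element of [L] is a quotient of values of [toK]. *)

Lemma mpoly_alg_ind (n : nat) (R : comNzRingType) (P : {mpoly R[n]} -> Prop) :
  (forall c, P c%:MP) -> (forall i, P 'X_i) ->
  (forall p q, P p -> P q -> P (p + q)) ->
  (forall p q, P p -> P q -> P (p * q)) -> forall p, P p.
Proof.
move=> PC PX PD PM p; rewrite (mpolyE p).
apply: big_ind => [|//|m _]; first by rewrite -mpolyC0.
rewrite -mul_mpolyC; apply: (PM) => //; rewrite mpolyXE_id.
apply: big_ind => [|p1 q1|i _]; [by rewrite -mpolyC1 | exact: PM |].
by elim: (m i) => [|e IH]; rewrite ?expr0 -?mpolyC1 // exprS; apply: PM.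
Qed.

Lemma submm n (m : 'X_{1..n}) : (m - m = 0)%MM.
Proof. by apply/mnmP => i; rewrite mnmBE subnn mnm0E. Qed.

Lemma mderivXU (R : nzRingType) n (i j : 'I_n) :
  mderiv i ('X_j : {mpoly R[n]}) = (j == i)%:R%:MP.
Proof.
rewrite mderivX mnm1E; case: eqP => [->|_]; last by rewrite scale0r mpolyC0.
by rewrite submm mpolyX0 scale1r mpolyC1.
Qed.

Lemma mderivXX (R : nzRingType) n (i : 'I_n) : mderiv i ('X_i : {mpoly R[n]}) = 1.
Proof. by rewrite mderivXU eqxx mpolyC1. Qed.

Lemma mderivX0 (R : nzRingType) n (i j : 'I_n) :
  j != i -> mderiv i ('X_j : {mpoly R[n]}) = 0.
Proof. by move=> ji; rewrite mderivXU (negbTE ji) mpolyC0. Qed.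

Section Derivations.
Variables (L : fieldType) (n : nat).
Implicit Types (d : {mpoly L[n]} -> {mpoly L[n]}) (p : {poly L}).

Definition pev m p (F : {mpoly L[m]}) : {mpoly L[m]} :=
  (map_poly (@mpolyC m L) p).[F].

Lemma pev0 m (F : {mpoly L[m]}) : pev 0 F = 0.
Proof. by rewrite /pev rmorph0 horner0. Qed.

Lemma pevC m c (F : {mpoly L[m]}) : pev c%:P F = c%:MP.
Proof. by rewrite /pev map_polyC hornerC. Qed.

Lemma pevX m (F : {mpoly L[m]}) : pev 'X F = F.
Proof. by rewrite /pev map_polyX hornerX. Qed.

Lemma pevD m p q (F : {mpoly L[m]}) : pev (p + q) F = pev p F + pev q F.
Proof. by rewrite /pev rmorphD hornerD. Qed.

Lemma pevN m p (F : {mpoly L[m]}) : pev (- p) F = - pev p F.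
Proof. by rewrite /pev rmorphN hornerN. Qed.

Lemma pevM m p q (F : {mpoly L[m]}) : pev (p * q) F = pev p F * pev q F.
Proof. by rewrite /pev rmorphM hornerM. Qed.

Lemma pevXn m j (F : {mpoly L[m]}) : pev 'X^j F = F ^+ j.
Proof. by rewrite /pev map_polyXn hornerXn. Qed.

Lemma pevZ m c p (F : {mpoly L[m]}) : pev (c *: p) F = c *: pev p F.
Proof. by rewrite -mul_polyC pevM pevC mul_mpolyC. Qed.

Lemma comp_pev m l (t : m.-tuple {mpoly L[l]}) p F :
  comp_mpoly t (pev p F) = pev p (comp_mpoly t F).
Proof.
elim/poly_ind: p => [|p c IH]; first by rewrite !pev0 comp_mpoly0.
by rewrite !pevD !pevM !pevC !pevX rmorphD rmorphM /= IH comp_mpolyC.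
Qed.

Lemma pev_comp m p q (F : {mpoly L[m]}) : pev (p \Po q) F = pev p (pev q F).
Proof.
elim/poly_ind: p => [|p c IH]; first by rewrite comp_poly0 !pev0.
by rewrite comp_polyD comp_polyM comp_polyX comp_polyC !pevD !pevM IH !pevC pevX.
Qed.

Lemma derivation0 d : is_derivation d -> d 0 = 0.
Proof. by case=> dD _ _; apply: (@addrI _ (d 0)); rewrite -dD !addr0. Qed.

Lemma derivation1 d : is_derivation d -> d 1 = 0.
Proof.
case=> _ _ dM; apply: (@addrI _ (d 1)).
by rewrite addr0 -[in RHS](mulr1 1) dM !mul1r.
Qed.

Lemma derivationC d c : is_derivation d -> d c%:MP = 0.
Proof.
by move=> dd; case: (dd) => _ dZ _; rewrite -[c%:MP]mulr1 mul_mpolyC dZ derivation1 ?scaler0.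
Qed.

Lemma derivationN d f : is_derivation d -> d (- f) = - d f.
Proof. by case=> _ dZ _; rewrite -scaleN1r dZ scaleN1r. Qed.

Lemma derivationB d f g : is_derivation d -> d (f - g) = d f - d g.
Proof. by move=> dd; case: (dd) => dD _ _; rewrite dD derivationN. Qed.

Lemma derivation_pev d p F : is_derivation d -> d (pev p F) = pev p^`() F * d F.
Proof.
move=> dd; case: (dd) => dD dZ dM.
elim/poly_ind: p => [|p c IH]; first by rewrite deriv0 !pev0 derivation0 // mul0r.
rewrite derivMXaddC !pevD !pevM !pevC !pevX dD dM IH derivationC // addr0.
by rewrite mulrDl mulrA [F * _]mulrC addrC [_ * F * _]mulrAC -mulrA addrC mulrA.
Qed.

Lemma derivation_comp m d (t : m.-tuple {mpoly L[n]}) r : is_derivation d ->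
  d (comp_mpoly t r) = \sum_i comp_mpoly t (mderiv i r) * d (tnth t i).
Proof.
move=> dd; case: (dd) => dD dZ dM.
elim/mpoly_alg_ind: r => [c|j|p q Hp Hq|p q Hp Hq].
- rewrite comp_mpolyC derivationC // big1 // => i _.
  by rewrite mderivC comp_mpoly0 mul0r.
- rewrite comp_mpolyXU (bigD1 j) //= big1 => [|i ij].
    rewrite mderivX mnm1E eqxx scale1r submm mpolyX0 comp_mpoly1 mul1r addr0.
    by rewrite (tnth_nth 0).
  by rewrite mderivX mnm1E eq_sym (negbTE ij) scale0r comp_mpoly0 mul0r.
- rewrite rmorphD dD Hp Hq -big_split; apply: eq_bigr => i _ /=.
  by rewrite mderivD rmorphD mulrDl.
- rewrite rmorphM dM Hp Hq !mulr_sumr -big_split; apply: eq_bigr => i _ /=.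
  by rewrite mderivM rmorphD !rmorphM mulrDl addrC; congr (_ + _);
     rewrite ?mulrA // [_ * comp_mpoly t q]mulrC.
Qed.

Lemma mderiv_derivation i : is_derivation (@mderiv n L i).
Proof.
split=> [f g|c f|f g]; rewrite ?mderivD ?mderivZ ?mderivM // addrC.
by rewrite [_ * g]mulrC.
Qed.

Lemma derivation_lin (E E' : {mpoly L[n]} -> {mpoly L[n]}) s s' :
  is_derivation E -> is_derivation E' -> is_derivation (fun g => s * E g + s' * E' g).
Proof.
move=> [D Z M] [D' Z' M']; split=> [f g|c f|f g].
- by rewrite D D'; ring.
- by rewrite Z Z' -!mul_mpolyC; ring.
- by rewrite M M'; ring.
Qed.

Lemma derivationE d f : is_derivation d -> d f = \sum_i mderiv i f * d 'X_i.
Proof.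
move=> dd; rewrite -[in LHS](comp_mpoly_id f) derivation_comp //.
by apply: eq_bigr => i _; rewrite comp_mpoly_id tnth_mktuple.
Qed.

Lemma derivation_ext d d' : is_derivation d -> is_derivation d' ->
  (forall i, d 'X_i = d' 'X_i) -> d =1 d'.
Proof.
by move=> dd dd' H f; rewrite !(derivationE f) //; apply: eq_bigr => i _; rewrite H.
Qed.

Lemma derivation_ext_coord m d d' (t : m.-tuple {mpoly L[n]}) :
  (forall f, exists r, f = comp_mpoly t r) ->
  is_derivation d -> is_derivation d' ->
  (forall i, d (tnth t i) = d' (tnth t i)) -> d =1 d'.
Proof.
move=> ct dd dd' H f; have [r ->] := ct f.
by rewrite !derivation_comp //; apply: eq_bigr => i _; rewrite H.
Qed.

End Derivations.

Section CharZero.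
Variables (L : fieldType) (n : nat).
Hypothesis char0 : [pchar L] =i pred0.

Lemma natf_eq0 m : (m%:R == 0 :> L) = (m == 0)%N.
Proof. exact: (iffLR (pcharf0P L) char0 m). Qed.

Lemma mulrS_eq0 (c : L) m : c *+ m.+1 = 0 -> c = 0.
Proof. by move/eqP; rewrite -mulr_natr mulf_eq0 natf_eq0 orbF => /eqP. Qed.

Lemma mcoeff_mderiv0 i (r : {mpoly L[n]}) (m : 'X_{1..n}) :
  mderiv i r = 0 -> m i != 0%N -> r@_m = 0.
Proof.
move=> H mi; have /submK Em: (U_(i) <= m)%MM by rewrite lep1mP.
have := congr1 (mcoeff (m - U_(i))%MM) H.
by rewrite mcoeff_deriv mcoeff0 Em => /mulrS_eq0.
Qed.

Lemma mderiv_const (r : {mpoly L[n]}) :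
  (forall i, mderiv i r = 0) -> r = (r@_0%MM)%:MP.
Proof.
move=> H; apply/mpolyP => m; rewrite mcoeffC.
case: (eqVneq m 0%MM) => [->|m0]; first by rewrite mulr1.
rewrite mulr0; have [i mi] : exists i, m i != 0%N.
  apply/existsP; apply: contraR m0 => /existsPn H0.
  by apply/eqP/mnmP => i; move: (H0 i); rewrite negbK mnm0E => /eqP.
exact: mcoeff_mderiv0 (H i) mi.
Qed.

Lemma msize_mderiv i (r : {mpoly L[n]}) : r != 0 -> (msize (mderiv i r) < msize r)%N.
Proof.
move=> r0; case: (ltnP (msize (mderiv i r)) (msize r)) => // H.
case: (eqVneq (mderiv i r) 0) H => [->|d0]; first by
  rewrite msize0 leqn0 msize_poly_eq0 (negbTE r0).
rewrite -(mlead_deg d0) => H.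
have := mlead_supp d0; set m := mlead _ in H *.
rewrite mcoeff_msupp mcoeff_deriv => /eqP []; rewrite memN_msupp_eq0 ?mul0rn //.
apply: (@msize_mdeg_ge _ _ r); by rewrite mdegD mdeg1 addn1.
Qed.

End CharZero.

(** * Jacobian matrices and algebraic independence of coordinates *)

Section Coordinates.
Variables (L : fieldType) (n : nat).
Hypothesis char0 : [pchar L] =i pred0.

(** Writing ['X_l = s_l(t)], the chain rule says that the Jacobian matrix of [t] times that of [s]
    evaluated at [t] is the identity. Over a commutative ring a one-sided inverse of a square matrix
    is two-sided, so the Jacobian matrix of [t] has no kernel. *)
Lemma coord_system_jacobian (t : n.-tuple {mpoly L[n]}) : coord_system t ->
  forall v : 'I_n -> {mpoly L[n]},
    (forall i, \sum_j v j * mderiv i (tnth t j) = 0) -> forall j, v j = 0.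
Proof.
move=> ct.
have ex l : exists r : {mpoly L[n]}, 'X_l == comp_mpoly t r.
  by case: (ct 'X_l) => r Hr; exists r; apply/eqP.
pose s l := xchoose (ex l).
have sE l : 'X_l = comp_mpoly t (s l) := eqP (xchooseP (ex l)).
move=> v Hv.
pose M : 'M[{mpoly L[n]}]_n := \matrix_(i, j) mderiv i (tnth t j).
pose N : 'M[{mpoly L[n]}]_n := \matrix_(j, l) comp_mpoly t (mderiv j (s l)).
have MN : M *m N = 1%:M.
  apply/matrixP => i l; rewrite !mxE.
  have := derivation_comp t (s l) (mderiv_derivation L i).
  rewrite -sE mderivX mnm1E => E.
  transitivity ((l == i)%:R *: ('X_[U_(l) - U_(i)] : {mpoly L[n]})).
    by rewrite E; apply: eq_bigr => j _; rewrite !mxE mulrC.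
  case: (eqVneq l i) => [->|li]; first by rewrite ?eqxx submm mpolyX0 scale1r.
  by rewrite scale0r ?(negbTE li) ?[i == l]eq_sym ?(negbTE li).
pose w : 'cV[{mpoly L[n]}]_n := \col_j v j.
have Mw : M *m w = 0.
  apply/colP => i; rewrite !mxE -[RHS](Hv i).
  by apply: eq_bigr => j _; rewrite !mxE mulrC.
have w0 : w = 0 by rewrite -[w]mul1mx -(mulmx1C MN) -mulmxA Mw mulmx0.
by move=> j; move/colP/(_ j): w0; rewrite !mxE.
Qed.

(** [coord_system] only asks that [t] generate; independence is deduced. Differentiating a relation
    [r(t) = 0] and cancelling the Jacobian matrix gives the relations [(d_j r)(t) = 0] of smaller
    degree. By induction all partial derivatives of [r] vanish, and in characteristic zero [r] is a
    constant. *)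
Lemma coord_system_inj0 (t : n.-tuple {mpoly L[n]}) r : coord_system t ->
  comp_mpoly t r = 0 -> r = 0.
Proof.
move=> ct; have [b] := ubnP (msize r); elim: b r => // b IH r Hb r0.
case: (eqVneq r 0) => // rn0.
have Hd : forall j, mderiv j r = 0.
  move=> j; apply: IH; first exact: leq_trans (msize_mderiv j rn0) Hb.
  move: j; apply: (coord_system_jacobian ct) => i.
  rewrite -(derivation_comp t r (mderiv_derivation L i)) r0.
  exact: mderiv0.
by move: r0; rewrite (mderiv_const char0 Hd) comp_mpolyC.
Qed.

Lemma coord_system_inj (t : n.-tuple {mpoly L[n]}) : coord_system t ->
  injective (comp_mpoly t).
Proof.
move=> ct p q E; apply/eqP; rewrite -subr_eq0; apply/eqP.
by apply: (coord_system_inj0 ct); rewrite rmorphB /= E subrr.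
Qed.

Lemma coord_system_inverse (t : n.-tuple {mpoly L[n]}) : coord_system t ->
  exists s : n.-tuple {mpoly L[n]},
    cancel (comp_mpoly t) (comp_mpoly s) /\ cancel (comp_mpoly s) (comp_mpoly t).
Proof.
move=> ct.
have ex l : exists r : {mpoly L[n]}, 'X_l == comp_mpoly t r.
  by case: (ct 'X_l) => r Hr; exists r; apply/eqP.
pose s := [tuple xchoose (ex l) | l < n]; exists s.
have H : cancel (comp_mpoly s) (comp_mpoly t).
  elim/mpoly_alg_ind => [c|i|p q Hp Hq|p q Hp Hq]; rewrite ?comp_mpolyC //.
  - by rewrite comp_mpolyXU -tnth_nth tnth_mktuple -(eqP (xchooseP (ex i))).
  - by rewrite !rmorphD /= Hp Hq.
  - by rewrite !rmorphM /= Hp Hq.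
by split=> // f; apply: (coord_system_inj ct); rewrite H.
Qed.

Lemma subalg1P (t : n.-tuple {mpoly L[n]}) i f :
  subalg t (pred1 i) f <-> exists p, f = pev p (tnth t i).
Proof.
split=> [[r [Hr ->]]|[p ->]].
  exists (\sum_(m <- msupp r) r@_m *: 'X^(m i)).
  rewrite comp_mpolyE big_seq [in RHS]big_seq.
  rewrite (big_morph (fun p => pev p (tnth t i)) (fun p q => pevD p q _) (pev0 _)).
  apply: eq_bigr => m mr; rewrite pevZ pevXn; congr (_ *: _).
  rewrite (bigD1 i) //= big1 ?mulr1 // => j ji.
  by rewrite (Hr m mr j) // inE.
exists (pev p 'X_i); split; last by rewrite comp_pev comp_mpolyXU -tnth_nth.
move=> m; rewrite /pev horner_coef => /msupp_sum_le /flattenP [s].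
case/mapP => j _ -> /=; rewrite coef_map /= mul_mpolyC => /msuppZ_le.
rewrite mpolyXn msuppX inE => /eqP -> l; rewrite inE eq_sym => li.
by rewrite mulmnE mnm1E (negbTE li).
Qed.

End Coordinates.

Lemma subalg_kernel (L : fieldType) n (d : {mpoly L[n]} -> {mpoly L[n]})
    (t : n.-tuple {mpoly L[n]}) (S : pred 'I_n) f :
  is_derivation d -> (forall i, i \in S -> d (tnth t i) = 0) ->
  subalg t S f -> d f = 0.
Proof.
move=> dd H [r [Hr ->]]; rewrite derivation_comp // big1 // => i _.
case: (boolP (i \in S)) => [/H ->|iS]; first by rewrite mulr0.
suff -> : mderiv i r = 0 by rewrite comp_mpoly0 mul0r.
apply/mpolyP => m; rewrite mcoeff_deriv mcoeff0 memN_msupp_eq0 ?mul0rn //.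
apply/negP => /Hr /(_ i iS); by rewrite mnmDE mnm1E eqxx addn1.
Qed.

Lemma natf_inj (L : fieldType) : [pchar L] =i pred0 -> injective (fun m : nat => m%:R : L).
Proof.
move=> char0 m1 m2; wlog le : m1 m2 / (m1 <= m2)%N.
  by move=> H E; case/orP: (leq_total m1 m2) => le; [|apply: esym]; apply: H.
move/eqP; rewrite eq_sym -subr_eq0 -natrB // (natf_eq0 char0) subn_eq0 => le'.
by apply/eqP; rewrite eqn_leq le.
Qed.

(** * Automorphisms of the plane *)

Lemma big_I2 (V : nmodType) (F : 'I_2 -> V) : \sum_i F i = F j0 + F j1.
Proof.
by rewrite !big_ord_recl big_ord0 addr0; congr (F _ + F _); apply: val_inj.
Qed.

Lemma prod_I2 (R : comNzRingType) (F : 'I_2 -> R) : \prod_i F i = F j0 * F j1.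
Proof.
by rewrite !big_ord_recl big_ord0 mulr1; congr (F _ * F _); apply: val_inj.
Qed.

Lemma I2P (P : 'I_2 -> Prop) : P j0 -> P j1 -> forall i, P i.
Proof.
by move=> P0 P1 [[|[|//]] lt]; [move: P0|move: P1]; congr P; apply: val_inj.
Qed.

Lemma mdegE2 (m : 'X_{1..2}) : mdeg m = (m j0 + m j1)%N.
Proof. by rewrite mdegE !big_ord_recl big_ord0 addn0; congr (m _ + m _)%N; apply: val_inj. Qed.

Lemma tuple2_eta (T : Type) (t : 2.-tuple T) : t = [tuple tnth t j0; tnth t j1].
Proof. by apply: eq_from_tnth; apply: I2P. Qed.

Lemma mlead_le (R : nzRingType) n (f : {mpoly R[n]}) M :
  (forall m, m \in msupp f -> (m <= M)%O) -> (mlead f <= M)%O.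
Proof.
move=> H; case: (eqVneq f 0) => [->|f0]; first by rewrite mlead0 le0m.
exact/H/mlead_supp.
Qed.

Lemma argmax_seq (T : eqType) (s : seq T) (f : T -> nat) : s != [::] ->
  exists2 x, x \in s & forall y, y \in s -> (f y <= f x)%N.
Proof.
elim: s => // x [|y s] IH _.
  by exists x; rewrite ?inE // => z; rewrite inE => /eqP ->.
have [//|z zs Hz] := IH; case: (leqP (f x) (f z)) => H.
  exists z; first by rewrite inE zs orbT.
  by move=> u; rewrite inE => /predU1P [->|/Hz].
exists x; first by rewrite inE eqxx.
move=> u; rewrite inE => /predU1P [-> //|/Hz] h.
by apply: leq_trans h _; apply: ltnW.
Qed.

Lemma gt1S2 n : (1 < n)%N -> exists a, n = a.+2.
Proof. by case: n => [|[|n]] // _; exists n. Qed.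

Lemma coprime_addn_ltn_muln p q : coprime p q -> (1 < p)%N -> (1 < q)%N ->
  (p + q < p * q)%N.
Proof.
move=> cpq /gt1S2 [a Ea] /gt1S2 [b Eb]; rewrite Ea Eb in cpq *.
case: a b {Ea Eb} cpq => [|a] [|b] // _; nia.
Qed.

(** Here [w] is the weight of a top monomial, [J] the number of Euler operators, [d] the degree of
    [mu], and [a + 1], [b + 1] the degrees of [F] and [G]. Since [p q >= p + q + 1], the hypotheses
    give [J (a + b + 2) + J d <= w d <= 1 + J (a + b)], that is [2 J + J d <= 1]. *)
Lemma incommensurable_arith J w p q d a b :
  (J * p * q <= w)%N -> (p + q < p * q)%N -> (0 < d)%N ->
  (a + b + 2 = d * (p + q))%N -> (w * d <= 1 + J * (a + b))%N -> J = 0%N.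
Proof.
move=> Jw pq d0 ab wd; case: (posnP J) => // J0.
have h1 : (J * (p + q).+1 * d <= J * (p * q) * d)%N.
  by rewrite leq_mul2r leq_mul2l pq !orbT.
have h2 : (J * (p * q) * d <= w * d)%N by rewrite leq_mul2r mulnA Jw orbT.
have h3 : (J * (p + q).+1 * d = J * (d * (p + q)) + J * d)%N.
  by rewrite mulnS mulnDl addnC -mulnA [((p + q) * d)%N]mulnC.
have h4 : (J * (a + b + 2) = J * (a + b) + J * 2)%N by rewrite mulnDr.
rewrite -ab h4 in h3.
have := leq_trans (leq_trans h1 h2) wd; rewrite h3; move: (J * (a + b))%N (J * d)%N => x y; lia.
Qed.

Section Plane.
Variable L : fieldType.
Hypothesis char0 : [pchar L] =i pred0.
Local Notation P2 := {mpoly L[2]}.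
Implicit Types F G H U V : P2.

Definition jac F G : P2 :=
  mderiv j0 F * mderiv j1 G - mderiv j1 F * mderiv j0 G.

Lemma jac_derivation F : is_derivation (jac F).
Proof.
split=> [f g|c f|f g]; rewrite /jac ?mderivD ?mderivZ ?mderivM.
- by ring.
- by rewrite -!mul_mpolyC; ring.
- by ring.
Qed.

Lemma jac_self F : jac F F = 0.
Proof. by rewrite /jac mulrC subrr. Qed.

(** The Jacobian determinant times that of the inverse pair is 1, and the units of a polynomial ring
    over a field are the nonzero constants. *)
Lemma jac_coord (t : 2.-tuple P2) : coord_system t ->
  exists2 c : L, c != 0 & jac (tnth t j0) (tnth t j1) = c%:MP.
Proof.
move=> ct; have [r Hr] := ct 'X_j0; have [s Hs] := ct 'X_j1.
have E i q := derivation_comp t q (mderiv_derivation L i).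
move: (E j0 r) (E j1 r) (E j0 s) (E j1 s); rewrite -Hr -Hs !big_I2.
rewrite !mderivX !mnm1E !eqxx !submm !mpolyX0 !scale1r.
rewrite !scale0r => E00 E10 E01 E11.
set A := comp_mpoly t (mderiv j0 r) in E00 E10.
set A' := comp_mpoly t (mderiv j1 r) in E00 E10.
set C := comp_mpoly t (mderiv j0 s) in E01 E11.
set C' := comp_mpoly t (mderiv j1 s) in E01 E11.
have U : (A * C' - A' * C) * jac (tnth t j0) (tnth t j1) = 1.
  rewrite /jac; set f0 := mderiv j0 _ in E00 E01 *; set f1 := mderiv j1 _ in E10 E11 *.
  set g0 := mderiv j0 _ in E00 E01 *; set g1 := mderiv j1 _ in E10 E11 *.
  have -> : (A * C' - A' * C) * (f0 * g1 - f1 * g0) =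
    (A * f0 + A' * g0) * (C * f1 + C' * g1) - (A * f1 + A' * g1) * (C * f0 + C' * g0).
    by ring.
  by rewrite -E00 -E11 -E10 -E01 mulr0 subr0 mulr1.
have := mpoly_intro_unit U; case/andP => /eqP J0; rewrite unitfE => J1.
by exists (jac (tnth t j0) (tnth t j1))@_0%MM.
Qed.

Lemma msizeM_bound F G a b : (msize F <= a.+1)%N -> (msize G <= b.+1)%N ->
  (msize (F * G) <= (a + b).+1)%N.
Proof.
case: (eqVneq F 0) => [->|F0]; first by rewrite mul0r msize0.
case: (eqVneq G 0) => [->|G0]; first by rewrite mulr0 msize0.
rewrite msizeM // => hF hG; rewrite -subn1 leq_subLR.
by rewrite addnS addSn -addnS -addSn addnS; apply: (leq_trans (leq_add hF hG)); rewrite addSn addnS.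
Qed.

Lemma msize_mderiv_bound F i a : (msize F <= a.+1)%N -> (msize (mderiv i F) <= a)%N.
Proof.
case: (eqVneq F 0) => [->|F0]; first by rewrite mderiv0 msize0.
by have := msize_mderiv i F0; lia.
Qed.

Lemma jac_size F U a u : (msize F <= a.+2)%N -> (msize U <= u.+2)%N ->
  (msize (jac F U) <= (a + u).+1)%N.
Proof.
move=> HF HU; have D i := msize_mderiv_bound i HF; have D' i := msize_mderiv_bound i HU.
rewrite /jac; apply: leq_trans (msizeD_le _ _) _.
by rewrite msizeN geq_max !msizeM_bound.
Qed.

Lemma mcoeff_Xmderiv i U m : ('X_i * mderiv i U)@_m = (m i)%:R * U@_m.
Proof.
case: (posnP (m i)) => [m0|m0].
  rewrite m0 mul0r mulrC; apply: memN_msupp_eq0; apply/negP.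
  rewrite (perm_mem (msuppMX _ _)) => /mapP [m' _ Em]; 
  by move: m0; rewrite Em mnmDE mnm1E eqxx.
have /submK Em : (U_(i) <= m)%MM by rewrite lep1mP -lt0n.
rewrite -[X in _@_X]Em mulrC addmC mcoeffMX mcoeff_deriv.
rewrite Em.
by rewrite mnmBE mnm1E eqxx subn1 prednK // [RHS]mulr_natl.
Qed.

Section Pair.
Variables F G : P2.
Hypothesis coordFG : coord_system [tuple F; G].
Local Notation ev := (comp_mpoly [tuple F; G]).

Lemma coord_nonconst : [/\ (1 < msize F)%N & (1 < msize G)%N].
Proof.
have [c c0] := jac_coord coordFG; rewrite /= !(tnth_nth 0) /= => J.
suff nc U : (forall i, mderiv i U = 0) \/ (1 < msize U)%N.
  split.
    case: (nc F) => // dF; move: J; rewrite /jac !dF !mul0r subrr => /esym/eqP.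
    by rewrite mpolyC_eq0 (negbTE c0).
  case: (nc G) => // dG; move: J; rewrite /jac !dG !mulr0 subrr => /esym/eqP.
  by rewrite mpolyC_eq0 (negbTE c0).
case: (ltnP 1 (msize U)) => [|HU]; [by right | left => i].
by rewrite (msize1_polyC HU) mderivC.
Qed.

(* The operator [H |-> Y H_Y - e H] multiplies the coefficient of [X^i Y^j] by
   [j - e]; since [H_Y(F,G) jac(F,G) = jac(F, H(F,G))], it raises the degree of
   [H(F,G)] by at most [deg F + deg G - 2]. *)
Definition euler (e : nat) H : P2 := 'X_j1 * mderiv j1 H - e%:R *: H.

Lemma mcoeff_euler e H m : (euler e H)@_m = ((m j1)%:R - e%:R) * H@_m.
Proof.
by rewrite /euler mcoeffB mcoeffZ mcoeff_Xmderiv mulrBl.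
Qed.

Lemma euler_size e H a b u :
  (msize F <= a.+2)%N -> (msize G <= b.+2)%N -> (msize (ev H) <= u.+1)%N ->
  (msize (ev (euler e H)) <= (u + (a + b)).+1)%N.
Proof.
move=> HF HG HU; have [c c0] := jac_coord coordFG.
rewrite !(tnth_nth 0) /= => J.
have E : ev (mderiv j1 H) = c^-1 *: jac F (ev H).
  rewrite (derivation_comp _ _ (jac_derivation F)) big_I2 !(tnth_nth 0) /=.
  by rewrite jac_self mulr0 add0r J mulrC mul_mpolyC scalerA mulVf ?scale1r.
rewrite /euler rmorphB /=; apply: leq_trans (msizeD_le _ _) _.
rewrite msizeN geq_max; apply/andP; split; last first.
  rewrite comp_mpolyZ; apply: leq_trans (msizeZ_le _ _) _.
  by apply: leq_trans HU _; lia.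
rewrite rmorphM /= comp_mpolyXU /= E -scalerAr.
apply: leq_trans (msizeZ_le _ _) _.
(* The degree bound for [jac] is stated for nonconstant bounds only; if [H(F,G)] is constant, the
   Jacobian is zero. *)
case: u HU => [|u] HU.
  by rewrite (msize1_polyC HU) /jac !mderivC !mulr0 subrr mulr0 msize0.
by apply: leq_trans (msizeM_bound HG (jac_size HF HU)) _; lia.
Qed.

Definition eulers (es : seq nat) H := foldr euler H es.

Lemma mcoeff_eulers es H m :
  (eulers es H)@_m = (\prod_(e <- es) ((m j1)%:R - e%:R)) * H@_m.
Proof.
elim: es => [|e es IH] /=; first by rewrite big_nil mul1r.
by rewrite mcoeff_euler IH big_cons mulrA.
Qed.

Lemma eulers_size es H a b u :
  (msize F <= a.+2)%N -> (msize G <= b.+2)%N -> (msize (ev H) <= u.+1)%N ->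
  (msize (ev (eulers es H)) <= (u + size es * (a + b)).+1)%N.
Proof.
move=> HF HG HU; elim: es => [|e es IH] /=; first by rewrite addn0.
by apply: leq_trans (euler_size e HF HG IH) _; lia.
Qed.

Variables (mu : 'X_{1..2}) (p q : nat).
Hypotheses (leadF : mlead F = (mu *+ p)%MM) (leadG : mlead G = (mu *+ q)%MM).
Hypothesis mu0 : (0 < mdeg mu)%N.
Local Notation wt m := (m j0 * p + m j1 * q)%N.

(** The leading monomial of [F^i G^j] is [mu] to the power [i p + j q]. If a single monomial of [H]
    attains the largest weight, its leading term cannot be cancelled in [H(F,G)]. *)
Lemma comp_top_coeff H (m' : 'X_{1..2}) : m' \in msupp H ->
  (forall m, m \in msupp H -> m != m' -> (wt m < wt m')%N) ->
  (wt m' * mdeg mu < msize (ev H))%N.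
Proof.
move=> m'H Hw.
have [F0 G0] : F != 0 /\ G != 0.
  by have [hF hG] := coord_nonconst; split; apply/negP => /eqP E;
     [move: hF | move: hG]; rewrite E msize0.
have lead (m : 'X_{1..2}) : mlead (F ^+ m j0 * G ^+ m j1) = (mu *+ wt m)%MM.
  rewrite mleadM ?expf_neq0 // !mleadX // leadF leadG.
  by apply/mnmP => i; rewrite mnmDE !mulmnE; lia.
suff nz : (ev H)@_(mu *+ wt m')%MM != 0.
  by have := msize_mdeg_lt (etrans (mcoeff_msupp _ _) nz); rewrite mdegMn mulnC.
rewrite comp_mpolyE raddf_sum /= (bigD1_seq m') ?msupp_uniq //=.
rewrite [X in _ + X]big_seq_cond [X in _ + X]big1 => [|m].
  rewrite addr0 mcoeffZ prod_I2 !(tnth_nth 0) /= -(lead m').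
  apply: mulf_neq0; first by rewrite -mcoeff_msupp.
  by rewrite mleadc_eq0 mulf_neq0 ?expf_neq0.
case/andP => mH mm'; rewrite mcoeffZ prod_I2 !(tnth_nth 0) /=.
rewrite [X in _ * X]mcoeff_gt_mlead ?mulr0 // lead; apply: lt_mdeg_ltmc.
by rewrite !mdegMn ltn_pmul2l // Hw.
Qed.

(* The top weighted form of [H] has at most [1 + w / (p q)] monomials, so at most
   [w / (p q)] operators [euler e] reduce it to a single one. *)
Lemma no_incommensurable_leads :
  coprime p q -> (1 < p)%N -> (1 < q)%N -> False.
Proof.
move=> cpq p1 q1.
have [hF hG] := coord_nonconst.
have [F0 G0] : F != 0 /\ G != 0.
  by split; apply/negP => /eqP E; [move: hF | move: hG]; rewrite E msize0.
have [H HX] := coordFG 'X_j0.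
have sX : msize (ev H) = 2%N by rewrite -HX msizeX mdeg1.
have H0 : H != 0 by apply/negP => /eqP E; rewrite E comp_mpoly0 msize0 in sX.
have [m' m'H Hmax] : exists2 m', m' \in msupp H &
    forall m, m \in msupp H -> (wt m <= wt m')%N.
  by apply: argmax_seq; rewrite msupp_eq0.
set w := wt m' in Hmax.
(* For monomials of weight [w] the exponent of [Y] is determined modulo [p], since [q] is invertible
   there, and it is at most [w / q]. Hence it lies in the progression [l], which has [J + 1]
   terms. *)
pose j := (m' j1 %% p)%N; pose J := ((w %/ q - j) %/ p)%N.
pose l := [seq (j + p * t)%N | t <- iota 0 J.+1].
have inl m : m \in msupp H -> wt m = w -> (m j1) \in l.
  move=> mH mw.
  have mj : (m j1 %% p = j)%N.
    apply/eqP; rewrite /j -(eqn_modDl (m j0 * p + m' j0 * p)).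
    suff : (m j1 == m' j1 %[mod p])%N by rewrite eqn_modDl.
    have E : (m j0 * p + m j1 * q = m' j0 * p + m' j1 * q)%N by [].
    case: (leqP (m' j1) (m j1)) => h.
      rewrite eqn_mod_dvd // -(Gauss_dvdl _ cpq).
      have -> : ((m j1 - m' j1) * q = (m' j0 - m j0) * p)%N by rewrite !mulnBl; lia.
      by rewrite dvdn_mull.
    rewrite eq_sym eqn_mod_dvd 1?ltnW // -(Gauss_dvdl _ cpq).
    have -> : ((m' j1 - m j1) * q = (m j0 - m' j0) * p)%N by rewrite !mulnBl; lia.
    by rewrite dvdn_mull.
  apply/mapP; exists (m j1 %/ p)%N.
    rewrite mem_iota /= add0n ltnS.
    have -> : (m j1 %/ p = (m j1 - j) %/ p)%N.
      rewrite [in RHS](divn_eq (m j1) p) mj addnK mulnK //; lia.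
    by apply: leq_div2r; apply: leq_sub2r; rewrite leq_divRL; lia.
  by rewrite [LHS](divn_eq (m j1) p) mj; lia.
have ul : uniq l.
  by rewrite map_inj_uniq ?iota_uniq // => x y /addnI /eqP; rewrite eqn_pmul2l ?(ltnW p1) // => /eqP.
(* Keeping the exponent of [m'] out of the list, [J] operators annihilate every other monomial of
   weight [w] and leave [m'] alive. *)
pose es := rem (m' j1) l.
have ses : size es = J by rewrite size_rem ?inl // size_map size_iota.
pose H1 := eulers es H.
have c1 m : (H1@_m != 0) -> (H@_m != 0) /\ m j1 \notin es.
  rewrite mcoeff_eulers mulf_eq0 negb_or => /andP [E ->]; split=> //.
  apply: contra E => me; rewrite (big_rem _ me) /= subrr mul0r; exact: eqxx.
have m'H1 : m' \in msupp H1.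
  rewrite mcoeff_msupp mcoeff_eulers mulf_neq0 -?mcoeff_msupp //.
  rewrite prodf_seq_neq0; apply/allP => e; rewrite mem_rem_uniq // inE => /andP [em _] /=.
  by apply: contra em; rewrite subr_eq0 => /eqP/(natf_inj char0) ->.
have top : forall m, m \in msupp H1 -> m != m' -> (wt m < wt m')%N.
  move=> m; rewrite mcoeff_msupp => /c1 []; rewrite -mcoeff_msupp => mH me mm'.
  rewrite ltn_neqAle Hmax // andbT; apply: contra me => /eqP mw.
  rewrite mem_rem_uniq // inE inl // andbT; apply: contra mm' => /eqP E1.
  have E0 : (m j0 * p == m' j0 * p)%N.
    by rewrite -(eqn_add2r (m' j1 * q)) -{1}E1; apply/eqP.
  rewrite eqn_pmul2r ?(ltnW p1) // in E0.
  by apply/eqP/mnmP; apply: I2P => //; apply/eqP.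
have low := comp_top_coeff m'H1 top; rewrite -/w in low.
have EF : (mdeg mu * p).+1 = msize F by rewrite -mlead_deg // leadF mdegMn.
have EG : (mdeg mu * q).+1 = msize G by rewrite -mlead_deg // leadG mdegMn.
have [a Ea] := gt1S2 hF; have [b Eb] := gt1S2 hG.
have up : (msize (ev H1) <= (1 + size es * (a + b)).+1)%N.
  by apply: eulers_size; rewrite ?Ea ?Eb ?sX.
rewrite ses in up.
have Jw : (J * p * q <= w)%N.
  apply: leq_trans (leq_trunc_div w q); rewrite leq_pmul2r; last exact: ltnW.
  by apply: leq_trans (leq_trunc_div _ p) _; apply: leq_subr.
have key : (w * mdeg mu <= 1 + J * (a + b))%N by rewrite -ltnS; apply: leq_trans low _.
have ab : (a + b + 2 = mdeg mu * (p + q))%N.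
  by move: EF EG; rewrite Ea Eb mulnDr => -[->] [->]; rewrite addn2 addSn addnS.
have J0 := incommensurable_arith Jw (coprime_addn_ltn_muln cpq p1 q1) mu0 ab key.
rewrite J0 mul0n addn0 in key.
(* With [J = 0] the degree bound gives [w <= 1], and [p, q > 1] allow no weight equal to 1. So [H]
   is constant, although [H(F,G)] is a variable. *)
have w0 : w = 0%N.
  have : (wt m' <= 1)%N by apply: leq_trans key; rewrite leq_pmulr.
  rewrite /w; clear -p1 q1; case: (m' j0) => [|x]; case: (m' j1) => [|y]; nia.
have : H = (H@_0%MM)%:MP.
  apply/mpolyP => m; rewrite mcoeffC; case: (eqVneq m 0%MM) => [->|m0]; rewrite ?mulr1 // mulr0.
  apply: memN_msupp_eq0; apply: contra m0 => /Hmax; rewrite w0 leqn0 => /eqP E.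
  by rewrite -mdeg_eq0 mdegE2; nia.
by move=> E; move: sX; rewrite E comp_mpolyC msizeC; case: eqP.
Qed.

End Pair.

(** Multiply [jac F G = c] by [X Y]. On the left, the coefficient at the product of the two leading
    monomials is the determinant of their exponents times the product of the leading coefficients.
    On the right only the monomial [X Y] occurs. So either the leading monomials multiply to [X Y]
    or the determinant is zero. *)
Lemma leads_parallel F G : coord_system [tuple F; G] ->
  (mlead F + mlead G = U_(j0) + U_(j1))%MM \/
  (mlead F j0 * mlead G j1 = mlead F j1 * mlead G j0)%N.
Proof.
move=> co; have [c c0] := jac_coord co; rewrite !(tnth_nth 0) /= => J.
have [hF hG] := coord_nonconst co.
have [F0 G0] : F != 0 /\ G != 0.
  by split; apply/negP => /eqP E; [move: hF | move: hG]; rewrite E msize0.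
pose X i U : P2 := 'X_i * mderiv i U.
have XE i U m : (X i U)@_m = (m i)%:R * U@_m.
  exact: mcoeff_Xmderiv.
have Xle i U : (mlead (X i U) <= mlead U)%O.
  apply: mlead_le => m; rewrite mcoeff_msupp XE mulf_eq0 negb_or => /andP [_].
  by rewrite -mcoeff_msupp => /msupp_le_mlead.
have E : X j0 F * X j1 G - X j1 F * X j0 G = c *: 'X_[U_(j0) + U_(j1)].
  by rewrite mpolyXD -mul_mpolyC -J /X /jac; ring.
have := congr1 (mcoeff (mlead F + mlead G)%MM) E.
rewrite mcoeffB !mleadcMW // !XE mcoeffZ mcoeffX.
case: (eqVneq (U_(j0) + U_(j1))%MM (mlead F + mlead G)%MM) => [<-|_]; first by left.
rewrite mulr0 => E0; right; apply/eqP; rewrite -(inj_eq (natf_inj char0)).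
have c1 : mleadc F * mleadc G != 0 by rewrite mulf_neq0 ?mleadc_eq0.
rewrite /= !natrM -subr_eq0; apply/eqP/(mulfI c1).
by rewrite mulr0 -[RHS]E0; ring.
Qed.

(** [p] and [q] are the two degrees divided by their gcd. Then [q m1 = p m2] in every exponent, so
    by coprimality [p] divides [m1], and [mu] is the quotient. *)
Lemma parallel_leads (m1 m2 : 'X_{1..2}) :
  (0 < mdeg m1)%N -> (0 < mdeg m2)%N -> (m1 j0 * m2 j1 = m1 j1 * m2 j0)%N ->
  exists (mu : 'X_{1..2}) (p q : nat),
    [/\ m1 = (mu *+ p)%MM, m2 = (mu *+ q)%MM, coprime p q, (0 < p)%N & (0 < q)%N].
Proof.
move=> d1 d2 E; set g := gcdn (mdeg m1) (mdeg m2).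
have g0 : (0 < g)%N by rewrite gcdn_gt0 d1.
have [p Ep] : exists p, mdeg m1 = (p * g)%N by apply/dvdnP; apply: dvdn_gcdl.
have [q Eq] : exists q, mdeg m2 = (q * g)%N by apply/dvdnP; apply: dvdn_gcdr.
have p0 : (0 < p)%N by case: p Ep d1 => // ->.
have q0 : (0 < q)%N by case: q Eq d2 => // ->.
have cpq : coprime p q.
  rewrite /coprime -(eqn_pmul2r g0) mul1n muln_gcdl -Ep -Eq; exact: eqxx.
have Em i : (q * m1 i = p * m2 i)%N.
  apply/eqP; rewrite -(eqn_pmul2r g0); apply/eqP.
  rewrite mulnAC -Eq mulnAC -Ep !mdegE2; move: i; apply: I2P; lia.
have dv i : (p %| m1 i)%N.
  by rewrite -(Gauss_dvdr _ cpq) Em dvdn_mulr.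
exists [multinom (m1 i %/ p)%N | i < 2], p, q; split => //.
  by apply/mnmP => i; rewrite mulmnE mnmE divnK.
apply/mnmP => i; rewrite mulmnE mnmE; apply/eqP.
rewrite -(eqn_pmul2l p0) -Em -{1}(divnK (dv i)); apply/eqP.
by rewrite [LHS]mulnC -[LHS]mulnA [RHS]mulnC -[RHS]mulnA [(q * p)%N]mulnC.
Qed.

Lemma coord_system_swap F G : coord_system [tuple F; G] -> coord_system [tuple G; F].
Proof.
move=> co f; have [r ->] := co f.
exists (comp_mpoly [tuple 'X_j1; 'X_j0] r).
elim/mpoly_alg_ind: r => [c||p q Hp Hq|p q Hp Hq]; rewrite ?comp_mpolyC //.
- by apply: I2P; rewrite !comp_mpolyXU.
- by rewrite !rmorphD /= Hp Hq.
- by rewrite !rmorphM /= Hp Hq.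
Qed.

Lemma coord_system_elementary F G p : coord_system [tuple F; G] ->
  coord_system [tuple F; G - pev p F].
Proof.
move=> co f; have [r ->] := co f.
exists (comp_mpoly [tuple 'X_j0; 'X_j1 + pev p 'X_j0] r).
elim/mpoly_alg_ind: r => [c||u v Hu Hv|u v Hu Hv]; rewrite ?comp_mpolyC //.
- apply: I2P; rewrite !comp_mpolyXU /= ?comp_mpolyXU //= rmorphD /= comp_pev.
  by rewrite !comp_mpolyXU /= subrK.
- by rewrite !rmorphD /= Hu Hv.
- by rewrite !rmorphM /= Hu Hv.
Qed.

(** * Jung's theorem: reduction of a coordinate pair to the variables *)

Section JungInduction.
Variable P : P2 -> P2 -> Prop.
Hypothesis Pbase : P 'X_j0 'X_j1.
Hypothesis Pswap : forall F G, P G F -> P F G.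
Hypothesis Ptri : forall (a b c : L) (p : {poly L}) F G, a != 0 -> c != 0 ->
  P (a *: F + b%:MP) (c *: G + pev p F) -> P F G.

Lemma tame_elementary F G p : P F (G - pev p F) -> P F G.
Proof.
move=> H; apply: (@Ptri 1 0 1 (- p)); rewrite ?oner_eq0 //.
by rewrite !scale1r mpolyC0 addr0 pevN.
Qed.

Lemma tame_triangular_affine (a b c e f : L) : a != 0 -> e != 0 ->
  P (a *: 'X_j0 + b%:MP) (c *: 'X_j0 + e *: 'X_j1 + f%:MP).
Proof.
move=> a0 e0; apply: (@Ptri a^-1 (- (a^-1 * b)) e^-1
   ((- (c / (a * e))) *: ('X - b%:P) - (f / e)%:P)); rewrite ?invr_eq0 //.
rewrite pevD pevN pevZ pevD pevN pevX !pevC addrK.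
have -> : a^-1 *: (a *: 'X_j0 + b%:MP) + (- (a^-1 * b))%:MP = 'X_j0 :> P2.
  rewrite scalerDr scalerA mulVf // scale1r -[a^-1 *: b%:MP]mul_mpolyC -mpolyCM.
  by rewrite mpolyCN addrK.
have -> : e^-1 *: (c *: 'X_j0 + e *: 'X_j1 + f%:MP) +
   (- (c / (a * e)) *: (a *: 'X_j0) - (f / e)%:MP) = 'X_j1 :> P2; last exact: Pbase.
rewrite !scalerDr !scalerA mulVf // scale1r -[e^-1 *: f%:MP]mul_mpolyC -mpolyCM.
have -> : - (c / (a * e)) * a = - (e^-1 * c) by field; rewrite ?a0 ?e0.
rewrite scaleNr [f / e]mulrC.
by move: (_ *: 'X_j0) (_%:MP) => U V; ring.
Qed.

Lemma affineE F : (msize F <= 2)%N ->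
  F = (F@_U_(j0)) *: 'X_j0 + (F@_U_(j1)) *: 'X_j1 + (F@_0%MM)%:MP.
Proof.
move=> HF; apply/mpolyP => m; rewrite !mcoeffD !mcoeffZ !mcoeffX mcoeffC.
case: (ltnP 1 (mdeg m)) => md.
  rewrite memN_msupp_eq0 ?msize_mdeg_ge ?(leq_trans HF) //.
  have d0 i : (U_(i)%MM == m) = false by apply/eqP => E; rewrite -E mdeg1 in md.
  have -> : (m == 0%MM) = false by apply/eqP => E; rewrite E mdeg0 in md.
  by rewrite !d0 !mulr0 !addr0.
case: (posnP (mdeg m)) => m0.
  move/eqP: m0; rewrite mdeg_eq0 => /eqP ->.
  by rewrite !mnm1_eq0 eqxx !mulr0 !add0r mulr1.
have /mdeg1P [i /eqP ->] : mdeg m == 1%N by lia.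
rewrite !eq_mnm1 mnm1_eq0 mulr0 addr0.
by move: i; apply: I2P; rewrite !(mulr0, mulr1, addr0, add0r).
Qed.

(* Jung's theorem, as an induction principle. *)
Lemma jung_ind F G : coord_system [tuple F; G] -> P F G.
Proof.
have [mu Hmu] : exists mu, mu = (mlead F + mlead G)%MM by eexists.
elim/(well_founded_ind (@ltom_wf 2)): mu F G Hmu => mu IH F G Hmu co.
have [hF hG] := coord_nonconst co.
have [F0 G0] : F != 0 /\ G != 0.
  by split; apply/negP => /eqP E; [move: hF | move: hG]; rewrite E msize0.
(* If the leading monomial of [V] is a power of that of [U], subtracting the matching multiple of
   [U^q] lowers it, and the induction on the product of the leading monomials applies. *)
have reduce U V q : coord_system [tuple U; V] -> mu = (mlead U + mlead V)%MM ->
    mlead V = (mlead U *+ q)%MM -> U != 0 -> V != 0 -> P U V.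
  move=> coU EU EV U0 V0.
  pose p : {poly L} := (mleadc V / mleadc (U ^+ q)) *: 'X^q.
  apply: (@tame_elementary _ _ p).
  have coV := coord_system_elementary p coU.
  apply: (IH _ _ _ _ erefl coV).
  rewrite EU ltmc_add2r.
  have [_ hV] := coord_nonconst coV.
  have V'0 : V - pev p U != 0 by apply/negP => /eqP E; move: hV; rewrite E msize0.
  have c0 : mleadc (U ^+ q) != 0 by rewrite mleadc_eq0 expf_neq0.
  have EUq : mlead (U ^+ q) = mlead V by rewrite mleadX.
  have lc : (V - pev p U)@_(mlead V) = 0.
    rewrite mcoeffB pevZ pevXn mcoeffZ -[X in _ * _@_X]EUq divfK //; exact: subrr.
  rewrite lt_neqAle; apply/andP; split.
    by apply/eqP => E; move: V'0; rewrite -mleadc_eq0 E lc eqxx.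
  apply: le_trans (mleadB_le _ _) _; rewrite leUx lexx /=.
  by rewrite pevZ pevXn -EUq mleadZ_le.
have dF : (0 < mdeg (mlead F))%N by rewrite -ltnS mlead_deg.
have dG : (0 < mdeg (mlead G))%N by rewrite -ltnS mlead_deg.
case: (leads_parallel co) => [E1|/(parallel_leads dF dG)]; last first.
  case=> nu [p [q [EF EG cpq p0 q0]]].
  have nu0 : (0 < mdeg nu)%N by move: dF; rewrite EF mdegMn muln_gt0 => /andP [].
  case: (ltngtP p 1%N) => [|p1|Ep]; first by rewrite ltnS leqNgt p0.
    case: (ltngtP q 1%N) => [|q1|Eq]; first by rewrite ltnS leqNgt q0.
      by case: (no_incommensurable_leads co EF EG nu0 cpq p1 q1).
    apply: Pswap; apply: (reduce _ _ p) => //; first exact: coord_system_swap.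
      by rewrite addmC.
    by rewrite EF EG Eq mulm1n.
  by apply: (reduce _ _ q) => //; rewrite EF EG Ep mulm1n.
(* Both degrees are positive and sum to 2, so the pair is affine. It remains to remove [Y] from one
   component and to treat a triangular affine pair. *)
have := congr1 (@mdeg 2) E1; rewrite !mdegD !mdeg1 => Ed.
have sF : (msize F <= 2)%N by rewrite -mlead_deg //; lia.
have sG : (msize G <= 2)%N by rewrite -mlead_deg //; lia.
have {reduce IH} tri U V : coord_system [tuple U; V] -> (msize U <= 2)%N ->
    (msize V <= 2)%N -> U@_U_(j1) = 0 -> P U V.
  move=> coU hU hV U1.
  have EU : U = (U@_U_(j0)) *: 'X_j0 + (U@_0%MM)%:MP.
    by rewrite {1}(affineE hU) U1 scale0r addr0.
  have [c c0] := jac_coord coU; rewrite !(tnth_nth 0) /= => J.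
  move: J; rewrite /jac EU (affineE hV) !mderivD !mderivZ !mderivC !mderivXU /=.
  rewrite !mpolyC1 !mpolyC0 !scaler0 !(addr0, add0r, mul0r, subr0).
  rewrite -scalerAl mul1r scalerA => /(congr1 (mcoeff 0%MM)).
  rewrite mcoeffZ mcoeff1 mcoeffC eqxx !mulr1 => E.
  have : U@_U_(j0) * V@_U_(j1) != 0 by rewrite E.
  rewrite mulf_eq0 negb_or => /andP [u0 v1].
  by rewrite EU (affineE hV); apply: tame_triangular_affine; rewrite -?EU -?(affineE hV).
case: (eqVneq F@_U_(j1) 0) => [|f1]; first exact: tri.
pose p : {poly L} := (G@_U_(j1) / F@_U_(j1)) *: 'X.
apply: (@tame_elementary _ _ p); apply: Pswap; apply: tri => //.
- exact/coord_system_swap/coord_system_elementary.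
- apply: leq_trans (msizeD_le _ _) _; rewrite geq_max sG msizeN pevZ pevX.
  exact: leq_trans (msizeZ_le _ _) sF.
- by rewrite mcoeffB pevZ pevX mcoeffZ divfK // subrr.
Qed.

End JungInduction.

End Plane.

(** * The embedding of [k[x,y,z]] into [K[y,z]] *)

Lemma big_I3 (V : nmodType) (F : 'I_3 -> V) : \sum_i F i = F i0 + F i1 + F i2.
Proof.
rewrite !big_ord_recl big_ord0 addr0 addrA.
by congr (F _ + F _ + F _); apply: val_inj.
Qed.

Lemma I3P (P : 'I_3 -> Prop) : P i0 -> P i1 -> P i2 -> forall i, P i.
Proof.
by move=> P0 P1 P2 [[|[|[|//]]] lt]; [move: P0|move: P1|move: P2]; congr P; apply: val_inj.
Qed.

Lemma msize_addC (R : nzRingType) n (f : {mpoly R[n]}) c :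
  (1 < msize f)%N -> msize (f + c%:MP) = msize f.
Proof.
move=> hf; apply/eqP; rewrite eqn_leq; apply/andP; split.
  apply: leq_trans (msizeD_le _ _) _; rewrite geq_max leqnn msizeC.
  by case: (c != 0) => //=; apply: ltnW.
have : (msize (f + c%:MP - c%:MP) <= maxn (msize (f + c%:MP)) 1)%N.
  apply: leq_trans (msizeD_le _ _) _; rewrite geq_max leq_maxl msizeN msizeC.
  by rewrite leq_max; case: (c != 0); rewrite ?orbT ?leq0n.
by rewrite addrK leq_max => /orP [//|]; rewrite leqNgt hf.
Qed.

Lemma msize_pev (L : fieldType) n (p : {poly L}) (F : {mpoly L[n]}) : p != 0 ->
  (1 < msize F)%N -> msize (pev p F) = ((size p).-1 * (msize F).-1).+1.
Proof.
move=> p0 hF; have F0 : F != 0 by apply/negP => /eqP E; rewrite E msize0 in hF.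
elim/poly_ind: p p0 => [|p c IH]; first by rewrite eqxx.
rewrite pevD pevM pevX pevC size_MXaddC.
case: (eqVneq p 0) => [->|p0] /=.
  rewrite mul0r add0r polyC_eq0 => c0; rewrite (negbTE c0) pev0 mul0r add0r.
  by rewrite msizeC c0 size_poly0 mul0n.
move=> _; have q0 : pev p F != 0 by rewrite -msize_poly_eq0 IH.
have s0 : (0 < size p)%N by rewrite size_poly_gt0.
have E : msize (pev p F * F) = (size p * (msize F).-1).+1.
  rewrite msizeM // IH // -[in RHS](prednK s0) mulSn -[in LHS](prednK (ltnW hF)).
  by rewrite addSn addnS /= addnC.
by rewrite msize_addC E // ltnS muln_gt0 s0; case: (msize F) hF => [|[]].
Qed.

Lemma pev_eq0 (L : fieldType) n (p : {poly L}) (F : {mpoly L[n]}) :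
  (1 < msize F)%N -> pev p F = 0 -> p = 0.
Proof.
move=> hF E; apply/eqP/negPn/negP => p0.
by have := msize_pev p0 hF; rewrite E msize0.
Qed.

Lemma plane_derivation_y (L : fieldType) (U V : {mpoly L[2]}) :
  U * mderiv j0 'X_j0 + V * mderiv j1 'X_j0 = U.
Proof. by rewrite mderivXX mderivX0 // mulr1 mulr0 addr0. Qed.

Lemma plane_derivation_z (L : fieldType) (U V : {mpoly L[2]}) :
  U * mderiv j0 'X_j1 + V * mderiv j1 'X_j1 = V.
Proof. by rewrite mderivXX mderivX0 // mulr1 mulr0 add0r. Qed.

Section Embedding.
Variables (k L : fieldType) (toK : {rmorphism {poly k} -> L}).
Hypothesis toK_inj : injective toK.
Hypothesis toK_frac : forall c : L, exists n d : {poly k}, d != 0 /\ toK d * c = toK n.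
Local Notation B := {mpoly k[3]}.
Local Notation KYZ := {mpoly L[2]}.
Local Notation BR := {mpoly {poly k}[2]}.

Lemma toK_eq0 (p : {poly k}) : (toK p == 0) = (p == 0).
Proof. by rewrite -(inj_eq toK_inj) rmorph0. Qed.

Lemma pchar_emb : [pchar k] =i pred0 -> [pchar L] =i pred0.
Proof.
move=> char0; apply/pcharf0P => m.
by rewrite -(rmorph_nat toK) toK_eq0 -polyC_natr polyC_eq0 natf_eq0.
Qed.

Definition emb_coef : k -> KYZ := @mpolyC 2 L \o toK \o polyC.
HB.instance Definition _ := GRing.RMorphism.copy emb_coef (@mpolyC 2 L \o toK \o polyC).

Definition emb_vars := tnth [tuple (toK 'X)%:MP; 'X_j0; 'X_j1 : KYZ].

(* With [toK] the embedding of [k[x]] into its fraction field, this is [iota]. *)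
Definition emb : B -> KYZ := mmap emb_coef emb_vars.
HB.instance Definition _ := GRing.RMorphism.copy emb (mmap emb_coef emb_vars).
Local Notation iota := emb.

Lemma iotaD (f g : B) : iota (f + g) = iota f + iota g. Proof. exact: rmorphD. Qed.
Lemma iotaM (f g : B) : iota (f * g) = iota f * iota g. Proof. exact: rmorphM. Qed.

Lemma iotaC c : iota c%:MP = (toK c%:P)%:MP.
Proof. by rewrite /emb mmapC. Qed.

Lemma iotaX i : iota 'X_i = emb_vars i.
Proof. by rewrite /emb mmapX mmap1U. Qed.

Lemma iota_x : iota (xB k) = (toK 'X)%:MP. Proof. exact: iotaX. Qed.
Lemma iota_y : iota (yB k) = 'X_j0. Proof. exact: iotaX. Qed.
Lemma iota_z : iota (zB k) = 'X_j1. Proof. exact: iotaX. Qed.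

Lemma iotaZ c f : iota (c *: f) = toK c%:P *: iota f.
Proof. by rewrite -mul_mpolyC iotaM iotaC mul_mpolyC. Qed.

Definition rx (p : {poly k}) : B := pev p (xB k).
Lemma rx_is_additive : zmod_morphism rx.
Proof. by move=> p q; rewrite /rx pevD pevN. Qed.
HB.instance Definition _ := GRing.isZmodMorphism.Build {poly k} B rx rx_is_additive.
Lemma rx_is_multiplicative : monoid_morphism rx.
Proof. by split=> [|p q]; rewrite /rx ?pevM // -polyC1 pevC mpolyC1. Qed.
HB.instance Definition _ := GRing.isMonoidMorphism.Build {poly k} B rx rx_is_multiplicative.

Lemma rxC c : rx c%:P = c%:MP. Proof. exact: pevC. Qed.
Lemma rxX : rx 'X = xB k. Proof. exact: pevX. Qed.

Lemma iota_rx p : iota (rx p) = (toK p)%:MP.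
Proof.
elim/poly_ind: p => [|p c IH]; first by rewrite !rmorph0.
by rewrite !rmorphD !rmorphM /= IH rxX rxC iota_x iotaC.
Qed.

(* The identification of [k[x,y,z]] with [k[x][y,z]]. *)
Definition iR_coef : k -> BR := @mpolyC 2 {poly k} \o polyC.
HB.instance Definition _ := GRing.RMorphism.copy iR_coef (@mpolyC 2 {poly k} \o polyC).
Definition iR : B -> BR := mmap iR_coef (tnth [tuple ('X : {poly k})%:MP; 'X_j0; 'X_j1]).
HB.instance Definition _ := GRing.RMorphism.copy iR
  (mmap iR_coef (tnth [tuple ('X : {poly k})%:MP; 'X_j0; 'X_j1])).
Definition jR : BR -> B := mmap rx (tnth [tuple yB k; zB k]).
HB.instance Definition _ := GRing.RMorphism.copy jR (mmap rx (tnth [tuple yB k; zB k])).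

Lemma iRC c : iR c%:MP = (c%:P)%:MP. Proof. by rewrite /iR mmapC. Qed.
Lemma iRX i : iR 'X_i = tnth [tuple ('X : {poly k})%:MP; 'X_j0; 'X_j1] i.
Proof. by rewrite /iR mmapX mmap1U. Qed.
Lemma jRC p : jR p%:MP = rx p. Proof. by rewrite /jR mmapC. Qed.
Lemma jRX i : jR 'X_i = tnth [tuple yB k; zB k] i.
Proof. by rewrite /jR mmapX mmap1U. Qed.

Lemma iRK : cancel iR jR.
Proof.
elim/mpoly_alg_ind => [c||p q Hp Hq|p q Hp Hq].
- by rewrite iRC jRC rxC.
- by apply: I3P; rewrite iRX ?jRC ?rxX ?jRX.
- by rewrite !rmorphD /= Hp Hq.
- by rewrite !rmorphM /= Hp Hq.
Qed.

Lemma iR_rx p : iR (rx p) = p%:MP.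
Proof.
elim/poly_ind: p => [|p c IH]; first by rewrite !rmorph0.
by rewrite !rmorphD !rmorphM /= IH rxX rxC iRX iRC.
Qed.

Lemma iota_iR (f : B) : iota f = map_mpoly toK (iR f).
Proof.
elim/mpoly_alg_ind: f => [c||p q Hp Hq|p q Hp Hq].
- by rewrite iRC iotaC map_mpolyC.
- by apply: I3P; rewrite iRX iotaX ?map_mpolyX // map_mpolyC.
- by rewrite !rmorphD /= Hp Hq.
- by rewrite !rmorphM /= Hp Hq.
Qed.

Lemma iota_inj : injective (iota).
Proof.
move=> f g E; apply: (can_inj iRK); apply/mpolyP => m; apply: toK_inj.
by have := congr1 (mcoeff m) E; rewrite !iota_iR !mcoeff_map_mpoly.
Qed.

Lemma iota_eq0 (f : B) : iota f = 0 -> f = 0.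
Proof. by move=> E; apply: iota_inj; rewrite E rmorph0. Qed.

Lemma iota_const (b : B) c : iota b = c%:MP -> exists p, b = rx p.
Proof.
move=> E; exists (iR b)@_0%MM; rewrite -jRC -[LHS]iRK; congr jR.
apply/mpolyP => m; apply: toK_inj; rewrite -mcoeff_map_mpoly -iota_iR E !mcoeffC.
case: eqP => [_|_]; last by rewrite !mulr0 rmorph0.
by rewrite !mulr1 -mcoeff_map_mpoly -iota_iR E mcoeffC eqxx mulr1.
Qed.

Lemma rx_inj : injective rx.
Proof. by move=> p q /(congr1 iR); rewrite !iR_rx => /eqP; rewrite mpolyC_eq => /eqP. Qed.

Lemma rx_eq0 p : (rx p == 0) = (p == 0).
Proof. by rewrite -(inj_eq rx_inj) rmorph0. Qed.

Lemma clear_denominators (f : KYZ) : exists (r : {poly k}) (b : B),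
  r != 0 /\ iota b = toK r *: f.
Proof.
elim/mpoly_alg_ind: f => [c||p q|p q].
- have [n [d [d0 E]]] := toK_frac c; exists d, (rx n); split=> //.
  by rewrite iota_rx -E mpolyCM mul_mpolyC.
- apply: I2P; [exists 1, (yB k)|exists 1, (zB k)];
    by rewrite oner_eq0 rmorph1 scale1r ?iota_y ?iota_z.
- case=> r [b [r0 E]] [s [c [s0 F]]].
  exists (r * s), (rx s * b + rx r * c); split; first by rewrite mulf_neq0.
  rewrite iotaD !iotaM !iota_rx E F !mul_mpolyC scalerDr !scalerA.
  by rewrite rmorphM [toK s * toK r]mulrC.
- case=> r [b [r0 E]] [s [c [s0 F]]].
  exists (r * s), (b * c); split; first by rewrite mulf_neq0.
  by rewrite iotaM E F -scalerAl -scalerAr scalerA rmorphM.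
Qed.

Lemma clear_denominators_poly (p : {poly L}) : exists (r : {poly k}) (c : {poly {poly k}}),
  r != 0 /\ map_poly toK c = toK r *: p.
Proof.
elim/poly_ind: p => [|p a [r [c [r0 E]]]].
  by exists 1, 0; rewrite oner_eq0 rmorph0 scaler0.
have [n [d [d0 Ed]]] := toK_frac a.
exists (r * d), (d *: c * 'X + (r * n)%:P); split; first by rewrite mulf_neq0.
rewrite rmorphD rmorphM /= map_polyC map_polyX map_polyZ E scalerA /=.
rewrite [in RHS]scalerDr -scalerAl [toK d * _]mulrC -rmorphM; congr (_ + _).
by rewrite -mul_polyC -polyCM; congr polyC; rewrite !rmorphM -Ed mulrA.
Qed.

Section Specialization.
Variables (kap : fieldType) (e : {rmorphism {poly k} -> kap}).

(** For [e] the projection from [k[x]] onto [k[x]/(p)], this is reduction of [k[x,y,z]] modulo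
    [p(x)]. *)
Definition spec : B -> {mpoly kap[2]} := map_mpoly e \o iR.
HB.instance Definition _ := GRing.RMorphism.copy spec (map_mpoly e \o iR).

Lemma spec_rx p : spec (rx p) = (e p)%:MP.
Proof. by rewrite /spec /= iR_rx map_mpolyC. Qed.

Lemma spec_eq0 p b : (forall q, e q = 0 -> p %| q) -> spec b = 0 ->
  exists b', b = rx p * b'.
Proof.
move=> H E; have E' : map_mpoly e (iR b) = 0 := E.
have Hm m : (iR b)@_m = p * ((iR b)@_m %/ p).
  by rewrite mulrC divpK // H // -mcoeff_map_mpoly E' mcoeff0.
exists (jR (\sum_(m <- msupp (iR b)) ((iR b)@_m %/ p) *: 'X_[m])).
rewrite -[LHS]iRK -jRC -rmorphM; congr jR.
rewrite [LHS]mpolyE mul_mpolyC scaler_sumr; apply: eq_bigr => m _.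
by rewrite scalerA -Hm.
Qed.

End Specialization.

(** Defined from the two values [d(y)] and [d(z)] alone, so that it is an [L]-linear derivation for
    every map [d]. It extends [d] when [d] is a derivation with [d(x) = 0]. *)
Definition dext (d : B -> B) : KYZ -> KYZ := fun g =>
  iota (d (yB k)) * mderiv j0 g + iota (d (zB k)) * mderiv j1 g.

Lemma dext_derivation d : is_derivation (dext d).
Proof. by apply: derivation_lin; exact: mderiv_derivation. Qed.

Lemma dext_eq d d' g : d =1 d' -> dext d g = dext d' g.
Proof. by move=> E; rewrite /dext !E. Qed.

Lemma dext_y d : dext d 'X_j0 = iota (d (yB k)).
Proof. exact: plane_derivation_y. Qed.

Lemma dext_z d : dext d 'X_j1 = iota (d (zB k)).
Proof. exact: plane_derivation_z. Qed.

Lemma dext_iota d (f : B) : is_derivation d -> d (xB k) = 0 ->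
  dext d (iota f) = iota (d f).
Proof.
move=> dd dx; have De := dext_derivation d.
elim/mpoly_alg_ind: f => [c||p q Hp Hq|p q Hp Hq].
- by rewrite iotaC !derivationC // rmorph0.
- apply: I3P.
  + by rewrite -/(xB k) iota_x derivationC // dx rmorph0.
  + by rewrite -/(yB k) iota_y dext_y.
  + by rewrite -/(zB k) iota_z dext_z.
- by case: De => DeD _ _; case: dd => dD _ _; rewrite iotaD DeD Hp Hq dD iotaD.
- case: De => _ _ DeM; case: dd => _ _ dM.
  by rewrite iotaM DeM Hp Hq dM iotaD !iotaM.
Qed.

(** The third coordinate becomes a scalar of [L], so the other two generate over [L] an algebra
    containing the image of [B], in particular [y] and [z]. *)
Lemma coord_system_iota (t : 3.-tuple B) c : coord_system t ->
  iota (tnth t i2) = c%:MP -> coord_system [tuple iota (tnth t i0); iota (tnth t i1)].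
Proof.
move=> ct Ec; set u := [tuple _; _].
have H r : exists s, iota (comp_mpoly t r) = comp_mpoly u s.
  elim/mpoly_alg_ind: r => [a||p q [s Es] [s' Es']|p q [s Es] [s' Es']].
  - by exists (toK a%:P)%:MP; rewrite !comp_mpolyC iotaC.
  - apply: I3P; [exists 'X_j0 | exists 'X_j1 | exists c%:MP];
      by rewrite ?comp_mpolyC ?comp_mpolyXU -?tnth_nth.
  - by exists (s + s'); rewrite !rmorphD /= Es Es'.
  - by exists (s * s'); rewrite !rmorphM /= Es Es'.
have H' b : exists s, iota b = comp_mpoly u s by have [r ->] := ct b.
elim/mpoly_alg_ind => [a||p q [s Es] [s' Es']|p q [s Es] [s' Es']].
- by exists a%:MP; rewrite comp_mpolyC.
- by apply: I2P; [have := H' (yB k); rewrite iota_y | have := H' (zB k); rewrite iota_z].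
- by exists (s + s'); rewrite !rmorphD /= Es Es'.
- by exists (s * s'); rewrite !rmorphM /= Es Es'.
Qed.

End Embedding.

(** * Derivations of the plane and complexity *)

Lemma coord_system_trans (L : fieldType) n (t t' : n.-tuple {mpoly L[n]}) :
  coord_system t -> (forall i, exists r, tnth t i = comp_mpoly t' r) -> coord_system t'.
Proof.
move=> ct H f; have [r ->] := ct f.
elim/mpoly_alg_ind: r => [c|i|p q [s Es] [s' Es']|p q [s Es] [s' Es']].
- by exists c%:MP; rewrite !comp_mpolyC.
- by have [r Hr] := H i; exists r; rewrite comp_mpolyXU -tnth_nth.
- by exists (s + s'); rewrite !rmorphD /= Es Es'.
- by exists (s * s'); rewrite !rmorphM /= Es Es'.
Qed.

Lemma antideriv (L : fieldType) : [pchar L] =i pred0 ->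
  forall s : {poly L}, exists S : {poly L}, S^`() = s.
Proof.
move=> char0 s; exists (\poly_(i < (size s).+1) (s`_i.-1 / i%:R)).
apply/polyP => i; rewrite coef_deriv coef_poly ltnS /=.
case: ltnP => [_|h]; last by rewrite mul0rn nth_default.
by rewrite -[LHS]mulr_natr divfK ?natf_eq0.
Qed.

Section PlaneDerivations.
Variable L : fieldType.
Hypothesis char0 : [pchar L] =i pred0.
Local Notation P2 := {mpoly L[2]}.
Implicit Types (F G : P2) (E : P2 -> P2).

Lemma derivation_pair_ext F G E E' : coord_system [tuple F; G] ->
  is_derivation E -> is_derivation E' -> E F = E' F -> E G = E' G -> E =1 E'.
Proof.
move=> co dE dE' EF EG; apply: (derivation_ext_coord co) => //.
by apply: I2P; rewrite !(tnth_nth 0).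
Qed.

Lemma derivation_pair_relation F G E1 E2 E3 (h : L) s : coord_system [tuple F; G] ->
  is_derivation E1 -> is_derivation E2 -> is_derivation E3 ->
  h *: E3 F = s * E2 F + E1 F -> h *: E3 G = s * E2 G + E1 G ->
  forall g, h *: E3 g = s * E2 g + E1 g.
Proof.
move=> co d1 d2 d3 HF HG g.
have := @derivation_pair_ext F G (fun g => h%:MP * E3 g + 0 * E3 g)
  (fun g => s * E2 g + 1 * E1 g) co (derivation_lin _ _ d3 d3) (derivation_lin _ _ d2 d1).
by rewrite !mul0r !addr0 !mul1r !mul_mpolyC => /(_ HF HG g); rewrite mul0r addr0 mul1r mul_mpolyC.
Qed.

(** In the coordinates [(F, G)] the derivation [E] is [c] times the partial derivative along [G],
    and in characteristic zero a polynomial killed by it does not involve [G]. *)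
Lemma plane_kernel F G E (c : L) s : coord_system [tuple F; G] -> is_derivation E ->
  E F = 0 -> E G = c%:MP -> c != 0 -> E s = 0 -> exists p, s = pev p F.
Proof.
move=> co dE EF EG c0 Es; have [r Hr] := co s.
suff /subalg1P [p Hp] : subalg [tuple F; G] (pred1 j0) s by exists p; rewrite Hp.
exists r; split=> // m mr; apply: I2P; rewrite inE ?eqxx // => _.
apply/eqP; apply: contraLR mr => m1; rewrite -mcoeff_eq0; apply/eqP.
apply: (mcoeff_mderiv0 char0 _ m1); apply: (coord_system_inj0 char0 co).
move: Es; rewrite Hr derivation_comp // big_I2 !(tnth_nth 0) /= EF mulr0 add0r EG.
by move/eqP; rewrite mulf_eq0 mpolyC_eq0 (negbTE c0) orbF => /eqP.
Qed.

Lemma mderiv_nilp n (r : {mpoly L[n]}) i m : (msize r <= m)%N -> iter m (mderiv i) r = 0.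
Proof.
elim: m r => [|m IH] r; first by rewrite leqn0 msize_poly_eq0 => /eqP.
move=> h; rewrite iterSr; apply: IH.
case: (eqVneq r 0) => [->|r0]; first by rewrite mderiv0 msize0.
by rewrite -ltnS; apply: leq_trans h; apply: msize_mderiv.
Qed.

Lemma plane_nilpotent F G E (c : L) : coord_system [tuple F; G] -> is_derivation E ->
  E F = 0 -> E G = c%:MP -> locally_nilpotent E.
Proof.
move=> co dE EF EG f; have [r ->] := co f; exists (msize r).
have H m : iter m E (comp_mpoly [tuple F; G] r) =
    c ^+ m *: comp_mpoly [tuple F; G] (iter m (mderiv j1) r).
  elim: m => [|m IH] /=; first by rewrite expr0 scale1r.
  case: (dE) => _ Z _; rewrite IH Z derivation_comp // big_I2 !(tnth_nth 0) /=.
  by rewrite EF mulr0 add0r EG mulrC mul_mpolyC scalerA -exprSr.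
by rewrite H mderiv_nilp // comp_mpoly0 scaler0.
Qed.

Lemma coord_system_tri F G (a b c : L) (p : {poly L}) : a != 0 -> c != 0 ->
  coord_system [tuple F; G] -> coord_system [tuple a *: F + b%:MP; c *: G + pev p F].
Proof.
move=> a0 c0 co; apply: (coord_system_trans co); set t := [tuple a *: F + _; _].
have t0 : tnth t j0 = a *: F + b%:MP by [].
have t1 : tnth t j1 = c *: G + pev p F by [].
have E0 : comp_mpoly t (a^-1 *: ('X_j0 - b%:MP)) = F.
  rewrite comp_mpolyZ rmorphB /= comp_mpolyXU -tnth_nth t0 comp_mpolyC addrK.
  by rewrite scalerA mulVf // scale1r.
apply: I2P; first by exists (a^-1 *: ('X_j0 - b%:MP)); rewrite E0.
exists (c^-1 *: ('X_j1 - pev p (a^-1 *: ('X_j0 - b%:MP)))).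
rewrite comp_mpolyZ rmorphB /= comp_pev E0 comp_mpolyXU -tnth_nth t1 addrK.
by rewrite scalerA mulVf // scale1r.
Qed.

(** Each of [F], [F'] is a polynomial in the other, hence they are affinely related; [G'] and the
    multiple of [G] with the same image differ by an element of the kernel. This is why the
    complexity does not depend on the pair attached to a derivation. *)
Lemma plane_slices F G F' G' E (c c' : L) :
  coord_system [tuple F; G] -> coord_system [tuple F'; G'] -> is_derivation E ->
  E F = 0 -> E F' = 0 -> E G = c%:MP -> E G' = c'%:MP -> c != 0 -> c' != 0 ->
  exists a b e p, [/\ a != 0, e != 0, F' = a *: F + b%:MP & G' = e *: G + pev p F].
Proof.
move=> co co' dE EF EF' EG EG' c0 c'0.
have [u Hu] := plane_kernel co dE EF EG c0 EF'.
have [v Hv] := plane_kernel co' dE EF' EG' c'0 EF.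
have [hF hG] := coord_nonconst co; have [hF' hG'] := coord_nonconst co'.
have uv : u != 0 by apply/negP => /eqP Z; move: hF'; rewrite Hu Z pev0 msize0.
have vu : v != 0 by apply/negP => /eqP Z; move: hF; rewrite Hv Z pev0 msize0.
(* Degrees multiply under substitution: [deg F' = deg u deg F] and [deg F = deg v deg F'] force
   degree one. *)
have su : size u = 2%N.
  have E1 : msize F' = ((size u).-1 * (msize F).-1).+1 by rewrite Hu msize_pev.
  have E2 : msize F = ((size v).-1 * (msize F').-1).+1.
    by rewrite {1}Hv msize_pev.
  move: E1 E2 hF hF'; move: (msize F) (msize F') (size u) (size v) => [|[|x]] // [|[|y]] //.
  move=> [|[|[|n]]] // [|[|m]] //=; nia.
exists u`_1, u`_0, (c' / c).
have Eu : u = u`_1 *: 'X + (u`_0)%:P.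
  apply/polyP => i; rewrite coefD coefZ coefX coefC.
  case: i => [|[|i]]; rewrite ?mulr0 ?add0r ?mulr1 ?addr0 //.
  by rewrite nth_default // su.
have [p Hp] : exists p, G' - (c' / c) *: G = pev p F.
  apply: (plane_kernel co dE EF EG c0); case: (dE) => _ Z _.
  by rewrite derivationB // Z EG EG' -mul_mpolyC -mpolyCM divfK // subrr.
exists p; split; rewrite ?mulf_neq0 ?invr_eq0 //.
- by have := lead_coef_eq0 u; rewrite lead_coefE su => ->.
- by rewrite Hu {1}Eu pevD pevZ pevX pevC.
- by rewrite -Hp addrC subrK.
Qed.

End PlaneDerivations.

Lemma chain_slope (L : fieldType) (f h c c' : L) : f != 0 -> h != 0 -> c' != 0 ->
  f * c' / h * (c / (f * c')) = c / h.
Proof. by move=> f0 h0 c'0; field; rewrite f0 h0 c'0. Qed.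

(** * Complexity by recursion, and chains read over the field of constants *)

Section Witnesses.
Variables (k L : fieldType) (toK : {rmorphism {poly k} -> L}).
Hypothesis charL : [pchar L] =i pred0.
Local Notation B := {mpoly k[3]}.
Local Notation KYZ := {mpoly L[2]}.
Local Notation iota := (emb toK).
Implicit Types (F G : KYZ).

Definition good F G := exists f g : B,
  [/\ F = iota f, G = iota g & coord_system [tuple xB k; f; g]].

(* The complexity of [(F, G)] is at most [m]; the case [m.+1] peels off the
   innermost factor [theta o tau_0]. *)
Fixpoint witness m F G : Prop := exists (a b c : L) (p : {poly L}),
  [/\ a != 0, c != 0 &
      if m is m'.+1 then witness m' (c *: G + pev p F) (a *: F + b%:MP)
      else good (a *: F + b%:MP) (c *: G + pev p F)].

(** Triangular maps are closed under composition, so one more of them is absorbed by the innermost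
    factor [tau_0] at no cost in swaps. *)
Lemma witness_tri m (a b c : L) p F G : a != 0 -> c != 0 ->
  witness m (a *: F + b%:MP) (c *: G + pev p F) -> witness m F G.
Proof.
move=> a0 c0 W.
have E1 (a' b' : L) :
    a' *: (a *: F + b%:MP) + b'%:MP = (a' * a) *: F + (a' * b + b')%:MP.
  by rewrite scalerDr scalerA -addrA -[a' *: b%:MP]mul_mpolyC -mpolyCM -mpolyCD.
have E3 : pev (a *: 'X + b%:P) F = a *: F + b%:MP by rewrite pevD pevZ pevX pevC.
have E2 (c' : L) (p' : {poly L}) : c' *: (c *: G + pev p F) + pev p' (a *: F + b%:MP) =
    (c' * c) *: G + pev (c' *: p + (p' \Po (a *: 'X + b%:P))) F.
  by rewrite scalerDr scalerA -addrA pevD pevZ pev_comp E3.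
case: m W => [|m] [a' [b' [c' [p' [a'0 c'0 W]]]]]; rewrite E1 E2 in W;
  by do 4!eexists; split; last exact: W; rewrite mulf_neq0.
Qed.

Lemma triangular1 F : 1 *: F + 0%:MP = F.
Proof. by rewrite scale1r mpolyC0 addr0. Qed.

Lemma triangular2 F G : 1 *: G + pev 0 F = G.
Proof. by rewrite scale1r pev0 addr0. Qed.

Lemma witness_swap m F G : witness m G F -> witness m.+1 F G.
Proof. by move=> W; exists 1, 0, 1, 0; rewrite oner_eq0 triangular1 triangular2. Qed.

Lemma witness_good F G : good F G -> witness 0 F G.
Proof. by move=> W; exists 1, 0, 1, 0; rewrite oner_eq0 triangular1 triangular2. Qed.

Lemma coord_systemX : coord_system [tuple xB k; yB k; zB k].
Proof.
move=> f; exists f; rewrite -[LHS]comp_mpoly_id; congr comp_mpoly.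
by apply: eq_from_tnth; apply: I3P; rewrite tnth_mktuple !(tnth_nth 0).
Qed.

Lemma witness_yz : witness 0 'X_j0 'X_j1.
Proof.
apply: witness_good; exists (yB k), (zB k); rewrite iota_y iota_z.
split=> //; exact: coord_systemX.
Qed.

Lemma witness_exists F G : coord_system [tuple F; G] -> exists m, witness m F G.
Proof.
apply: (jung_ind charL (P := fun F G => exists m, witness m F G)).
- by exists 0%N; apply: witness_yz.
- by move=> U V [m /witness_swap W]; exists m.+1.
- by move=> a b c p U V a0 c0 [m /(witness_tri a0 c0) W]; exists m.
Qed.

(* Along a chain of derivations of [K[y,z]], the relation
   [h E_i = s E_{i-1} + f E_{i-2}] with [s = s(F_{i-1})] makes
   [F_i = F_{i-2} - S(F_{i-1})], with [S'] proportional to [s], a generator of the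
   kernel of [E_i]. *)
Lemma chain_analysis (E : nat -> KYZ -> KYZ) l F1 F2 :
  coord_system [tuple F2; F1] -> witness 0 F2 F1 ->
  (forall i, is_derivation (E i)) ->
  E 1%N F1 = 0 -> E 1%N F2 = 1 -> E 2%N F2 = 0 -> E 2%N F1 = 1 ->
  (forall i, (3 <= i <= l)%N -> exists (s : KYZ) (f h : L),
     [/\ f != 0, h != 0, E i.-1 s = 0 &
         forall g, h *: E i g = s * E i.-1 g + f *: E i.-2 g]) ->
  forall n, (n.+2 <= l)%N -> exists F G (c c' : L),
    [/\ coord_system [tuple F; G], witness n F G, c != 0 & c' != 0] /\
    [/\ E n.+2 F = 0, E n.+2 G = c%:MP, E n.+1 G = 0 & E n.+1 F = c'%:MP].
Proof.
move=> co w dE E11 E12 E22 E21 rel; elim=> [|n IH] hn.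
  by exists F2, F1, 1, 1; rewrite oner_eq0 mpolyC1.
have [F [G [c [c' [[coFG wFG c0 c'0] [EF EG E'G E'F]]]]]] := IH (ltnW hn).
have [s [f [h [f0 h0 /= Es relE]]]] := rel n.+3 hn.
have [q Hq] := plane_kernel charL coFG (dE _) EF EG c0 Es.
(* The new derivation sends [F] to [f c' / h] and [G] to [c s / h], where [s = q(F)]. It kills
   [G - S(F)] precisely when [S' = (c / (f c')) q]. *)
have [S HS] := antideriv charL ((c / (f * c')) *: q).
have EnF : E n.+3 F = (f * c' / h)%:MP.
  apply: (scalerI h0); rewrite relE EF mulr0 add0r E'F -!mul_mpolyC -!mpolyCM.
  by rewrite [h * _]mulrC divfK.
have EnG : E n.+3 G = (c / h) *: s.
  apply: (scalerI h0); rewrite relE EG E'G scaler0 addr0 mulrC mul_mpolyC scalerA.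
  by rewrite [h * _]mulrC divfK.
exists (G - pev S F), F, (f * c' / h), c; split; split; rewrite ?mulf_neq0 ?invr_eq0 //.
- exact/coord_system_swap/coord_system_elementary.
- apply/witness_swap/(@witness_tri _ 1 0 1 S); rewrite ?oner_eq0 //.
  by rewrite !scale1r mpolyC0 addr0 subrK.
- rewrite derivationB // derivation_pev // HS EnF EnG pevZ -Hq -scalerAl [s * _]mulrC mul_mpolyC.
  by rewrite scalerA [_ * (f * c' / h)]mulrC chain_slope // subrr.
- by rewrite derivationB // derivation_pev // EF mulr0 subr0.
Qed.

End Witnesses.

(** * From plane derivations to irreducible derivations of the polynomial ring *)

Section Descent.
Variables (k L : fieldType) (toK : {rmorphism {poly k} -> L}).
Hypothesis toK_inj : injective toK.
Hypothesis toK_frac : forall c : L, exists n d : {poly k}, d != 0 /\ toK d * c = toK n.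
Hypothesis charL : [pchar L] =i pred0.
Local Notation B := {mpoly k[3]}.
Local Notation KYZ := {mpoly L[2]}.
Local Notation iota := (emb toK).
Local Notation dext := (dext toK).

Lemma msize_rx (p : {poly k}) : p != 0 -> msize (rx p) = size p.
Proof.
move=> p0; have sx : msize (xB k) = 2%N by rewrite msizeX mdeg1.
by rewrite msize_pev ?sx // muln1 prednK // size_poly_gt0.
Qed.

(** Here [c] is the common content of [U] and [V] in [k[x]]. Dividing out a nonconstant common
    factor lowers the sum of the sizes, so the process ends with a primitive pair. *)
Lemma primitive_pair (U V : B) : (U != 0) || (V != 0) ->
  exists (c : {poly k}) (U' V' : B), [/\ c != 0, U = rx c * U', V = rx c * V' &
    forall p, mdvd (rx p) U' -> mdvd (rx p) V' -> (size p <= 1)%N].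
Proof.
have [n] := ubnP (msize U + msize V); elim: n U V => // n IH U V hn nz.
have [[p [p1 [U1 EU] [V1 EV]]]|H] := classic (exists p : {poly k},
    [/\ (1 < size p)%N, mdvd (rx p) U & mdvd (rx p) V]); last first.
  exists 1, U, V; rewrite oner_eq0 rmorph1 !mul1r; split=> // p pU pV.
  by rewrite leqNgt; apply/negP => p1; apply: H; exists p.
have p0 : p != 0 by rewrite -size_poly_gt0; apply: ltnW.
have le (W W1 : B) : W = rx p * W1 -> (W1 != 0 -> (msize W1 < msize W)%N) /\
    (W1 == 0 -> W == 0).
  move=> ->; split=> [W0|/eqP ->]; last by rewrite mulr0.
  rewrite msizeM ?rx_eq0 // msize_rx //; move: (msize W1) => w.
  by case: (size p) p1 => [|[|s]] // _; rewrite !addSn /= ltnS leq_addl.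
have [lU zU] := le _ _ EU; have [lV zV] := le _ _ EV.
have nz1 : (U1 != 0) || (V1 != 0).
  by move: nz; rewrite -!negb_and; apply: contra => /andP [/zU -> /zV ->].
have hn1 : (msize U1 + msize V1 < n)%N.
  rewrite ltnS in hn; apply: leq_trans hn.
  case: (eqVneq U1 0) nz1 lU => [->|U0] /= => [V0 _|_ lU].
    rewrite msize0 add0n; apply: leq_trans (lV V0) _; exact: leq_addl.
  case: (eqVneq V1 0) lV => [-> _|V0 lV].
    rewrite msize0 addn0; apply: leq_trans (lU isT) _; exact: leq_addr.
  by rewrite -addSn leq_add ?lU // ltnW ?lV.
have [c [U' [V' [c0 EU' EV' prim]]]] := IH U1 V1 hn1 nz1.
exists (p * c), U', V'; rewrite mulf_neq0 //; split=> //.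
  by rewrite EU EU' rmorphM mulrA.
by rewrite EV EV' rmorphM mulrA.
Qed.

Lemma const_divisor (c : B) (Q : KYZ) a : a != 0 -> iota c * Q = a%:MP ->
  exists2 p, p != 0 & c = rx p.
Proof.
move=> a0 E; have U : (a^-1 *: Q) * iota c = 1.
  by rewrite mulrC -scalerAr E -mul_mpolyC -mpolyCM mulVf.
have /andP [/eqP E0 _] := mpoly_intro_unit U.
have [p Ep] := iota_const toK_inj E0; exists p => //.
apply/negP => /eqP p0; move: E; rewrite Ep p0 !rmorph0 mul0r.
by move/esym/eqP; rewrite mpolyC_eq0 (negbTE a0).
Qed.

(* Clear the denominators of [jac F] and divide by its content. *)
Lemma descent (F G : KYZ) : coord_system [tuple F; G] ->
  exists (d : B -> B) (c : L), [/\ is_LND d, irreducible_der d, d (xB k) = 0, c != 0 &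
    dext d F = 0 /\ dext d G = c%:MP].
Proof.
move=> co; have [a a0] := jac_coord co; rewrite !(tnth_nth 0) /= => J0.
pose E := jac F; have J : E G = a%:MP := J0; have dE : is_derivation E := jac_derivation F.
have [r1 [U [r10 EU]]] := clear_denominators toK_frac (E 'X_j0).
have [r2 [V [r20 EV]]] := clear_denominators toK_frac (E 'X_j1).
have nz : (rx r2 * U != 0) || (rx r1 * V != 0).
  rewrite -negb_and !mulf_eq0 !rx_eq0 (negbTE r10) (negbTE r20) /=.
  apply/negP => /andP [/eqP U0 /eqP V0].
  have z r (W : KYZ) (b : B) : r != 0 -> b = 0 -> iota b = toK r *: W -> W = 0.
    move=> r0 -> /esym; rewrite rmorph0 => /eqP; rewrite mscalerI toK_eq0 //.
    by rewrite (negbTE r0) => /eqP.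
  have : E G = 0.
    by rewrite derivationE // big_I2 (z _ _ _ r10 U0 EU) (z _ _ _ r20 V0 EV) !mulr0 addr0.
  by rewrite J => /eqP; rewrite mpolyC_eq0 (negbTE a0).
have [c [U' [V' [c0 EU' EV' prim]]]] := primitive_pair nz.
pose d : B -> B := fun f => U' * mderiv i1 f + V' * mderiv i2 f.
have dd : is_derivation d by apply: derivation_lin; apply: mderiv_derivation.
have dx : d (xB k) = 0 by rewrite /d /xB !mderivX0 // !mulr0 addr0.
have dy : d (yB k) = U' by rewrite /d /yB mderivXX mderivX0 // mulr1 mulr0 addr0.
have dz : d (zB k) = V' by rewrite /d /zB mderivXX mderivX0 // mulr1 mulr0 add0r.
pose u : L := toK (r1 * r2) / toK c.
have tc0 : toK c != 0 by rewrite toK_eq0.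
have u0 : u != 0 by rewrite mulf_neq0 ?invr_eq0 // toK_eq0 // mulf_neq0.
have scal (W : B) (X : KYZ) : toK c *: iota W = toK (r1 * r2) *: X -> iota W = u *: X.
  by move=> H; apply: (scalerI tc0); rewrite H scalerA /u [toK c * _]mulrC divfK.
have Ed : dext d =1 (fun g => u%:MP * E g + 0 * E g).
  apply: derivation_ext; [exact: dext_derivation | exact: derivation_lin |].
  apply: I2P; rewrite mul0r addr0 mul_mpolyC ?dext_y ?dext_z ?dy ?dz; apply: scal.
    rewrite -mul_mpolyC -iota_rx -iotaM -EU' iotaM iota_rx EU mul_mpolyC scalerA.
    by rewrite rmorphM mulrC.
  rewrite -mul_mpolyC -iota_rx -iotaM -EV' iotaM iota_rx EV mul_mpolyC scalerA.
  by rewrite rmorphM.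
have {}Ed g : dext d g = u *: E g by rewrite Ed mul0r addr0 mul_mpolyC.
have dF : dext d F = 0 by rewrite Ed /E jac_self scaler0.
have dG : dext d G = (u * a)%:MP by rewrite Ed J -mul_mpolyC -mpolyCM.
have de f : iota (d f) = dext d (iota f) by rewrite dext_iota.
exists d, (u * a); split; [split=> // | | exact: dx | by rewrite mulf_neq0 | by []].
  move=> f; have [m Hm] := plane_nilpotent co (dext_derivation toK d) dF dG (iota f).
  exists m; apply: (iota_eq0 toK_inj); rewrite -[RHS]Hm.
  by elim: (m) => //= m' IH; rewrite de IH.
(* A common divisor [c1] of the image of [d] divides [d(b)] for a multiple [b] of [G] by an element
   of [k[x]], and [d(b)] is a nonzero constant over [L]. Hence [c1] lies in [k[x]]; dividing [d(y)]
   and [d(z)], it is constant by primitivity. *)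
move=> c1 Hc1; have [r [b [r0 Eb]]] := clear_denominators toK_frac G.
have [Q HQ] := Hc1 b.
have EQ : iota c1 * iota Q = (toK r * (u * a))%:MP.
  case: (dext_derivation toK d) => _ dZ _.
  by rewrite -iotaM -HQ de Eb dZ dG -mul_mpolyC -mpolyCM.
have ra0 : toK r * (u * a) != 0 by apply: mulf_neq0; [rewrite toK_eq0 | apply: mulf_neq0].
have [p p0 Ep] := const_divisor ra0 EQ.
have sp : (size p <= 1)%N by apply: prim; rewrite -Ep -?dy -?dz; apply: Hc1.
have Ep' := size1_polyC sp; exists p`_0.
by split; [rewrite -polyC_eq0 -Ep' | rewrite Ep {1}Ep' rxC].
Qed.

(** Every value of [d] is a multiple of its value on the only coordinate that it may move, so
    irreducibility makes that value a nonzero constant. *)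
Lemma irreducible_slice n (t : n.-tuple {mpoly k[n]}) (d : {mpoly k[n]} -> {mpoly k[n]}) i :
  coord_system t -> is_derivation d -> irreducible_der d ->
  (forall j, j != i -> d (tnth t j) = 0) -> exists a : k, a != 0 /\ d (tnth t i) = a%:MP.
Proof.
move=> ct dd irr H; apply: irr => f; have [r ->] := ct f.
exists (comp_mpoly t (mderiv i r)); rewrite derivation_comp // (bigD1 i) //=.
by rewrite big1 ?addr0 1?mulrC // => j /H ->; rewrite mulr0.
Qed.

End Descent.

(** * Chains from decompositions *)

Section Construction.
Variables (k L : fieldType) (toK : {rmorphism {poly k} -> L}).
Hypothesis toK_inj : injective toK.
Hypothesis toK_frac : forall c : L, exists n d : {poly k}, d != 0 /\ toK d * c = toK n.
Hypothesis charL : [pchar L] =i pred0.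
Local Notation B := {mpoly k[3]}.
Local Notation KYZ := {mpoly L[2]}.
Local Notation iota := (emb toK).
Local Notation dext := (dext toK).
Local Notation witness := (witness toK).

Lemma derivation_tri_inv (E : KYZ -> KYZ) a b c p (F G W : KYZ) u :
  is_derivation E -> a != 0 -> c != 0 ->
  E (a *: F + b%:MP) = u%:MP -> E (c *: G + pev p F) = W ->
  E F = (a^-1 * u)%:MP /\ E G = c^-1 *: W + pev (- (c^-1 * (a^-1 * u)) *: p^`()) F.
Proof.
move=> dE a0 c0 EF EG; case: (dE) => dD dZ _.
have {}EF : E F = (a^-1 * u)%:MP.
  move: EF; rewrite dD dZ derivationC // addr0 => EF.
  by apply: (scalerI a0); rewrite EF -mul_mpolyC -mpolyCM mulrA mulfV // mul1r.
split=> //; apply: (scalerI c0).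
move: EG; rewrite dD dZ derivation_pev // EF mulrC mul_mpolyC => <-.
rewrite pevZ !scalerDr !scalerA !mulfV // !mul1r mulrN mulVKf //.
by rewrite scaleNr addrK.
Qed.

(** On the coordinates [(F', F)] the relation [h D = s D' + D1] amounts to [h v = c2] and
    [0 = s c1 + q(F')], which determine [h] and [s] over [L]. Clearing their denominators multiplies
    [D1] by the common denominator, which becomes [f]. *)
Lemma chain_step_relation (D D' D1 : B -> B) (F F' : KYZ) (c1 c2 v a : L) (q : {poly L}) :
  coord_system [tuple F'; F] -> a != 0 -> c1 != 0 -> c2 != 0 -> v != 0 ->
  is_derivation D -> is_derivation D' -> is_derivation D1 ->
  D (xB k) = 0 -> D' (xB k) = 0 -> D1 (xB k) = 0 ->
  dext D F = 0 -> dext D F' = v%:MP -> dext D' F' = 0 -> dext D' F = (a^-1 * c1)%:MP ->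
  dext D1 F' = c2%:MP -> dext D1 F = a^-1 *: pev q F' ->
  exists (s : B) (f h : {poly k}), [/\ D' s = 0, f != 0, h != 0 &
    forall g, rx h * D g = s * D' g + rx f * D1 g].
Proof.
move=> co a0 c10 c20 v0 dD dD' dD1 Dx D'x D1x EF EF' E'F' E'F E1F' E1F.
pose h := c2 / v; have h0 : h != 0 by rewrite mulf_neq0 ?invr_eq0.
pose s := pev (- c1^-1 *: q) F'.
have key g : h *: dext D g = s * dext D' g + dext D1 g.
  apply: (derivation_pair_relation co); try exact: dext_derivation.
    by rewrite EF' E'F' E1F' mulr0 add0r -mul_mpolyC -mpolyCM divfK.
  rewrite EF E'F E1F scaler0 /s pevZ -scalerAl [_ * (_)%:MP]mulrC mul_mpolyC.
  by rewrite scalerA mulNr [a^-1 * c1]mulrC mulKf // scaleNr addNr.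
have [r [s1 [r0 Es]]] := clear_denominators toK_frac s.
have [n [d [d0 En]]] := toK_frac h.
have n0 : n != 0.
  by rewrite -(toK_eq0 toK_inj) -En mulf_neq0 // toK_eq0.
exists (rx d * s1), (r * d), (r * n); split; rewrite ?mulf_neq0 //.
  apply: (iota_eq0 toK_inj); rewrite -dext_iota // iotaM iota_rx Es mul_mpolyC.
  have dE := dext_derivation toK D'; case: (dE) => _ dZ _.
  by rewrite 2!dZ /s (derivation_pev _ _ dE) E'F' mulr0 !scaler0.
move=> g; apply: (iota_inj toK_inj).
rewrite iotaD !iotaM !iota_rx -!dext_iota // Es !mul_mpolyC -!scalerAl scalerA.
rewrite !rmorphM -En -[toK d * toK r]mulrC -scalerDr -key scalerA.
by rewrite mulrA.
Qed.

(** Without swaps, [(f, g, x)] is a coordinate system in which [D] moves only [g]. The derivation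
    obtained by descent from the swapped pair moves only [f]. Rescaling [f] and [g] turns both into
    partial derivatives. *)
Lemma good_base F G D c : coord_system [tuple F; G] -> witness 0 F G -> is_LND D ->
  irreducible_der D -> D (xB k) = 0 -> dext D F = 0 -> dext D G = c%:MP -> c != 0 ->
  exists t ds c' q,
    [/\ coord_system t, tnth t i2 = xB k & full_irr_MC_chain D t ds 2] /\
    [/\ dext (ds 1%N) F = c'%:MP, c' != 0 & dext (ds 1%N) G = pev q F].
Proof.
move=> co [a [b [c0 [p [a0 c00 [f [g [Ef Eg cfg]]]]]]]] LD irD Dx DF DG cn0.
have cot := coord_system_tri b p a0 c00 co.
have [d0 [c1 [Ld ird dx c10 [dG dF]]]] :=
  descent toK_inj toK_frac (coord_system_swap cot).
case: (LD) (Ld) => [dD _] [dd _].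
have Df : D f = 0.
  apply: (iota_eq0 toK_inj); rewrite -dext_iota // -Ef.
  case: (dext_derivation toK D) => DD DZ _.
  by rewrite DD DZ DF scaler0 derivationC ?addr0 //; apply: dext_derivation.
have dg : d0 g = 0 by apply: (iota_eq0 toK_inj); rewrite -dext_iota // -Eg.
have [a1 [a10 Dg]] : exists a : k, a != 0 /\ D g = a%:MP.
  apply: (@irreducible_slice k 3 _ D i2 cfg) => //.
  by apply: I3P; rewrite ?eqxx // !(tnth_nth 0).
have [a2 [a20 df]] : exists a : k, a != 0 /\ d0 f = a%:MP.
  apply: (@irreducible_slice k 3 _ d0 i1 cfg) => //.
  by apply: I3P; rewrite ?eqxx // !(tnth_nth 0).
pose t : 3.-tuple B := [tuple a2^-1 *: f; a1^-1 *: g; xB k].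
pose ds i := if i == 1%N then d0 else D.
have [EF EG] := derivation_tri_inv (dext_derivation toK d0) a0 c00 dF dG.
exists t, ds, (a^-1 * c1), (- (c0^-1 * (a^-1 * c1)) *: p^`()); split; last first.
  by split; rewrite ?mulf_neq0 ?invr_eq0 // EG scaler0 add0r.
have partial (d : B -> B) (e : k) (w : B) : is_derivation d -> e != 0 -> d w = e%:MP ->
    d (e^-1 *: w) = 1.
  by move=> [_ dZ _] e0 E; rewrite dZ E -mul_mpolyC -mpolyCM mulVf // mpolyC1.
have zero (d : B -> B) (e : k) (w : B) : is_derivation d -> d w = 0 -> d (e^-1 *: w) = 0.
  by move=> [_ dZ _] E; rewrite dZ E scaler0.
split=> //.
  apply: (coord_system_trans cfg); apply: I3P.
  - by exists 'X_i2; rewrite comp_mpolyXU.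
  - exists (a2 *: 'X_i0); rewrite comp_mpolyZ comp_mpolyXU !(tnth_nth 0) /=.
    by rewrite scalerA mulfV // scale1r.
  - exists (a1 *: 'X_i1); rewrite comp_mpolyZ comp_mpolyXU !(tnth_nth 0) /=.
    by rewrite scalerA mulfV // scale1r.
split; last by move=> i /andP [i3 i2']; have := leq_trans i3 i2'.
split=> //.
- split=> //; apply: I3P; rewrite !(tnth_nth 0) /=; [exact: partial | exact: zero | exact: dx].
- move=> _; split=> //; apply: I3P; rewrite !(tnth_nth 0) /=;
    [exact: zero | exact: partial | exact: Dx].
- by move=> i; rewrite /ds; case: ifP => _ _; split.
Qed.

(** The induction also records how the derivation before the last acts on [(F, G)]: a nonzero
    constant on [F] and a polynomial in [F] on [G]. This is exactly what allows the next relation of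
    the chain to be solved. *)
Lemma chain_of_witness m F G D c : coord_system [tuple F; G] -> witness m F G ->
  is_LND D -> irreducible_der D -> D (xB k) = 0 ->
  dext D F = 0 -> dext D G = c%:MP -> c != 0 ->
  exists t ds c' q,
    [/\ coord_system t, tnth t i2 = xB k & full_irr_MC_chain D t ds m.+2] /\
    [/\ dext (ds m.+1) F = c'%:MP, c' != 0 & dext (ds m.+1) G = pev q F].
Proof.
elim: m F G D c => [|m IH] F G D c; first exact: good_base.
move=> co [a [b [c0 [p [a0 c00 W]]]]] LD irD Dx DF DG cn0.
have cot := coord_system_swap (coord_system_tri b p a0 c00 co).
(* [D'] is the predecessor of [D] in the chain: the irreducible derivation killing the first
   component of the pair left after [theta o tau_0]. *)
have [D' [c1 [LD' irD' D'x c10 [D'F' D'G']]]] := descent toK_inj toK_frac cot.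
have [t [ds [c2 [q [[ct tx ch] [E1F' c20 E1G']]]]]] :=
  IH _ _ _ _ cot W LD' irD' D'x D'F' D'G' c10.
case: ch => [[_ P1 P2 Eds all] rel].
have [LDp irDp Dpx] := all m.+1 (leqnSn _).
rewrite tx in Dpx.
have [E2F E2G] := derivation_tri_inv (dext_derivation toK D') a0 c00 D'G' D'F'.
have co' : coord_system [tuple c0 *: G + pev p F; F].
  by have := coord_system_swap (coord_system_tri 0 p (oner_neq0 L) c00 co);
     rewrite triangular1.
have DF' : dext D (c0 *: G + pev p F) = (c0 * c)%:MP.
  case: (dext_derivation toK D) => DD DZ _.
  rewrite DD DZ DG derivation_pev ?DF ?mulr0 ?addr0 -?mul_mpolyC -?mpolyCM //.
  exact: dext_derivation.
have E1F : dext (ds m.+1) F = a^-1 *: pev q (c0 *: G + pev p F).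
  rewrite -E1G'; case: (dext_derivation toK (ds m.+1)) => DD DZ _.
  rewrite DD DZ derivationC ?addr0 ?scalerA ?mulVf ?scale1r //; exact: dext_derivation.
have [s [f [h [D's f0 h0 relD]]]] := chain_step_relation co' a0 c10 c20
  (mulf_neq0 c00 cn0) (proj1 LD) (proj1 LD') (proj1 LDp) Dx D'x Dpx DF DF' D'F' E2F E1F' E1F.
pose ds' i := if i == m.+3 then D else ds i.
exists t, ds', (a^-1 * c1), (- (c0^-1 * (a^-1 * c1)) *: p^`()).
have dsE j : (j < m.+3)%N -> ds' j = ds j by move=> h'; rewrite /ds' ltn_eqF.
have dsl : ds' m.+3 = D by rewrite /ds' eqxx.
have E2 g : dext (ds' m.+2) g = dext D' g by apply: dext_eq => b'; rewrite dsE.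
split; last first.
  by rewrite !E2; split; [exact: E2F | rewrite mulf_neq0 ?invr_eq0 | rewrite E2G scaler0 add0r].
have rxt (r : {poly k}) : r != 0 -> subalg t (pred1 i2) (rx r) /\ rx r != 0.
  by move=> r0; rewrite rx_eq0 r0; split=> //; apply/subalg1P; exists r; rewrite tx.
split=> //; split.
  split=> //.
  - by rewrite dsl.
  - move=> i /andP [i1' i2']; case: (eqVneq i m.+3) => [->|ne].
      by rewrite dsl; split; rewrite ?tx.
    have ilt : (i < m.+3)%N by rewrite ltn_neqAle ne.
    by rewrite dsE //; apply: all; rewrite i1'.
move=> i /andP [i3 i3']; case: (eqVneq i m.+3) => [->|ne].
  exists s, (rx f), (rx h); rewrite dsl !dsE //=; split; auto; first by rewrite Eds.
  by move=> g; rewrite Eds.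
have ilt : (i < m.+3)%N by rewrite ltn_neqAle ne.
have i1lt : (i.-1 < m.+3)%N := leq_ltn_trans (leq_pred i) ilt.
have i2lt : (i.-2 < m.+3)%N := leq_ltn_trans (leq_pred _) i1lt.
have [s' [f' [h' R]]] := rel i (introT andP (conj i3 ilt)).
by exists s', f', h'; rewrite !dsE.
Qed.

End Construction.

(** * Variables in the kernel of a derivation of rank two *)

Lemma irreducible_factor (k : fieldType) (r : {poly k}) : (1 < size r)%N ->
  exists p : {poly k}, irreducible_poly p /\ p %| r.
Proof.
have [n] := ubnP (size r); elim: n r => // n IH r hn r1.
have [irr|red] := classic (irreducible_poly r); first by exists r.
have [q [q1 qr nqr]] : exists q : {poly k}, [/\ size q != 1%N, q %| r & ~~ (q %= r)].
  apply: NNPP => H; apply: red; split=> // q q1 qr.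
  by apply/negPn/negP => nqr; apply: H; exists q.
have r0 : r != 0 by rewrite -size_poly_gt0; apply: ltnW.
have q0 : q != 0 by apply/negP => /eqP E; rewrite E dvd0p (negbTE r0) in qr.
have lt : (size q < size r)%N by rewrite ltn_neqAle dvdp_leq // andbT dvdp_size_eqp.
have q2 : (1 < size q)%N by move: q1 q0; rewrite -size_poly_gt0; case: (size q) => [|[|]].
have [p [ip pq]] := IH q (leq_trans lt hn) q2.
by exists p; split=> //; apply: dvdp_trans qr.
Qed.

(** The field [k[x]/(p)], obtained by adjoining a root of [p] to [k]. Surjectivity of [e] serves to
    lift polynomials over it back to [k[x]]. *)
Lemma residue_field (k : fieldType) (p : {poly k}) : irreducible_poly p ->
  exists (kap : fieldType) (e : {rmorphism {poly k} -> kap}),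
    [/\ e p = 0, forall q, e q = 0 -> p %| q & forall z, exists q, e q = z].
Proof.
move=> ip; have [F _ [z rz gz]] := irredp_FAdjoin ip.
pose e : {rmorphism {poly k} -> F} := horner_alg z.
have eE q : e q = (map_poly (in_alg F) q).[z] by [].
have ep : e p = 0 by apply/eqP.
exists F, e; split=> // [q eq0|u].
  case: (boolP (coprimep p q)) => [/Bezout_eq1_coprimepP [[u v] /= E]|].
    have := congr1 e E; rewrite rmorphD !rmorphM ep eq0 !mulr0 addr0 rmorph1.
    by move/eqP; rewrite eq_sym oner_eq0.
  rewrite /coprimep => g1; have := ip.2 _ g1 (dvdp_gcdl p q).
  by move/eqp_dvdl => <-; apply: dvdp_gcdr.
have : u \in <<1; z>>%VS by rewrite gz memvf.
case/Fadjoin_polyP => f /polyOver1P [q ->] ->.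
by exists q.
Qed.

Lemma size_comp_const (R : idomainType) (p q : {poly R}) :
  (1 < size p)%N -> size (p \Po q) = 1%N -> (size q <= 1)%N.
Proof.
move=> p1 E; have := size_comp_poly p q; rewrite E => /esym/eqP.
rewrite muln_eq0 => /orP [|]; first by case: (size p) p1 => [|[|]].
by case: (size q) => [|[|]].
Qed.

Section MpolyAux.
Variables (k : fieldType) (n : nat).
Hypothesis char0 : [pchar k] =i pred0.

Lemma mpoly_antideriv (i : 'I_n) (r : {mpoly k[n]}) : exists R, mderiv i R = r.
Proof.
exists (\sum_(m <- msupp r) (r@_m / (m i).+1%:R) *: 'X_[m + U_(i)]).
rewrite raddf_sum [RHS]mpolyE; apply: eq_bigr => m _ /=.
rewrite mderivZ mderivX addmK scalerA mnmDE mnm1E eqxx addn1 divfK //.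
by rewrite natf_eq0.
Qed.

(* The degree in [T] of [f(X_i + T)] is additive in [f] on products, and vanishes only
   if [f] does not depend on [X_i]. *)
Definition shift (i : 'I_n) : {mpoly k[n]} -> {poly {mpoly k[n]}} :=
  mmap (polyC \o @mpolyC n k) (fun j => ('X_j)%:P + (if j == i then 'X else 0)).
HB.instance Definition _ i := GRing.RMorphism.copy (shift i)
  (mmap (polyC \o @mpolyC n k) (fun j => ('X_j)%:P + (if j == i then 'X else 0))).

Lemma shiftC i c : shift i c%:MP = (c%:MP)%:P.
Proof. by rewrite /shift mmapC. Qed.

Lemma shiftX i j : shift i 'X_j = ('X_j)%:P + (if j == i then 'X else 0).
Proof. by rewrite /shift mmapX mmap1U. Qed.

Lemma shiftD i f g : shift i (f + g) = shift i f + shift i g.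
Proof. exact: rmorphD. Qed.

Lemma shiftM i f g : shift i (f * g) = shift i f * shift i g.
Proof. exact: rmorphM. Qed.

Lemma shift0 i f : (shift i f).[0] = f.
Proof.
elim/mpoly_alg_ind: f => [c|j|p q Hp Hq|p q Hp Hq].
- by rewrite shiftC hornerC.
- by rewrite shiftX hornerD hornerC; case: ifP => _; rewrite ?hornerX ?horner0 addr0.
- by rewrite shiftD hornerD; congr (_ + _).
- by rewrite shiftM hornerM; congr (_ * _).
Qed.

Lemma shift_deriv i f : ((shift i f)^`()).[0] = mderiv i f.
Proof.
elim/mpoly_alg_ind: f => [c|j|p q Hp Hq|p q Hp Hq].
- by rewrite shiftC derivC horner0 mderivC.
- rewrite shiftX derivD derivC add0r mderivXU.
  by case: eqP => _; rewrite ?derivX ?deriv0 ?hornerC ?horner0 ?mpolyC1 ?mpolyC0.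
- by rewrite shiftD derivD hornerD mderivD; congr (_ + _).
- by rewrite shiftM derivM hornerD !hornerM mderivM; congr (_ * _ + _ * _); rewrite ?shift0.
Qed.

Lemma shift_pev i p f : shift i (pev p f) = (map_poly (@mpolyC n k) p) \Po shift i f.
Proof.
elim/poly_ind: p => [|p c IH]; first by rewrite pev0 map_poly0 comp_poly0 raddf0.
rewrite pevD pevM pevX pevC shiftD shiftM rmorphD rmorphM /= IH shiftC map_polyC map_polyX.
by rewrite comp_polyD comp_polyM comp_polyX comp_polyC.
Qed.

Lemma shift_size1 i f : (size (shift i f) <= 1)%N -> mderiv i f = 0.
Proof. by move=> h; rewrite -shift_deriv (size1_polyC h) derivC horner0. Qed.

Lemma size_shift_eq0 i f : f != 0 -> (0 < size (shift i f))%N.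
Proof.
move=> f0; rewrite lt0n size_poly_eq0; apply: contra f0 => /eqP E.
by rewrite -(shift0 i f) E horner0.
Qed.

(** As [g] is unchanged by the shift, its factor [p(W)] has degree 0 in [T], and since [p] is
    nonconstant so has the shift of [W]. *)
Lemma divisor_mderiv0 i (g W V : {mpoly k[n]}) (p : {poly k}) : (1 < size p)%N ->
  g != 0 -> shift i g = g%:P -> g = pev p W * V -> mderiv i W = 0.
Proof.
move=> p1 g0 Eg E; apply: shift_size1.
have [u0 v0] : pev p W != 0 /\ V != 0.
  by apply/andP; rewrite -negb_or -mulf_eq0 -E.
have := congr1 (fun f => size (shift i f)) E.
rewrite /= Eg size_polyC g0 shiftM size_mul; last 2 first.
- by rewrite -size_poly_gt0 size_shift_eq0.
- by rewrite -size_poly_gt0 size_shift_eq0.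
have su := size_shift_eq0 i u0; have sv := size_shift_eq0 i v0.
move=> sE; have aux a b : (0 < a)%N -> (0 < b)%N -> 1%N = (a + b).-1 -> a = 1%N.
  by case: a b => [|a] [|b] //= _ _; rewrite addnS; case: a.
have {}sE := aux _ _ su sv sE.
apply: (@size_comp_const _ (map_poly (@mpolyC n k) p)).
  by rewrite size_map_inj_poly // => u v /eqP; rewrite mpolyC_eq => /eqP.
by rewrite -sE shift_pev.
Qed.

End MpolyAux.

(** Take [t] as the variables: [q(y_3)] is free of the other two, hence so is its factor [p(x)],
    hence so is [x]. Thus [x = w(y_3)], and [x] having degree one forces [w] to be affine. *)
Lemma variable_of_divisor (k : fieldType) (t : 3.-tuple {mpoly k[3]}) (p q : {poly k}) a :
  [pchar k] =i pred0 -> coord_system t -> q != 0 -> (1 < size p)%N ->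
  pev q (tnth t i2) = rx p * a ->
  exists c d, c != 0 /\ xB k = c *: tnth t i2 + d%:MP.
Proof.
move=> char0 ct q0 p1 E.
have [s [tK sK]] := coord_system_inverse char0 ct.
pose W := comp_mpoly s (xB k).
have sX : comp_mpoly s (tnth t i2) = 'X_i2.
  by rewrite -[RHS]tK comp_mpolyXU -tnth_nth.
have EW : pev q 'X_i2 = pev p W * comp_mpoly s a.
  by rewrite -sX -comp_pev E rmorphM /= /rx comp_pev.
have X1 : (1 < msize ('X_i2 : {mpoly k[3]}))%N by rewrite msizeX mdeg1.
have g0 : pev q ('X_i2 : {mpoly k[3]}) != 0.
  by rewrite -msize_poly_eq0 msize_pev.
have dW i : i != i2 -> mderiv i W = 0.
  move=> ii; apply: (divisor_mderiv0 p1 g0 _ EW).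
  rewrite shift_pev shiftX eq_sym (negbTE ii) addr0.
  exact: comp_polyCr.
have [w Ew] : exists w, W = pev w 'X_i2.
  have [w Hw] : exists w, W = pev w (tnth [tuple 'X_i | i < 3] i2).
    apply/subalg1P; exists W; split; last by rewrite comp_mpoly_id.
    move=> m mW j; rewrite inE => ji; apply/eqP; apply: contraLR mW => mj.
    by rewrite -mcoeff_eq0; apply/eqP; apply: (mcoeff_mderiv0 char0 (dW j ji)).
  by exists w; rewrite Hw tnth_mktuple.
have Ex : xB k = pev w (tnth t i2).
  by rewrite -[LHS]sK -/W Ew comp_pev comp_mpolyXU -tnth_nth.
have sx : msize (xB k) = 2%N by rewrite msizeX mdeg1.
have t1 : (1 < msize (tnth t i2))%N.
  rewrite ltnNge; apply/negP => /msize1_polyC Et; move: sx.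
  have -> : xB k = (w.[(tnth t i2)@_0%MM])%:MP.
    rewrite Ex Et mpolyCK; elim/poly_ind: (w) => [|u c IH].
      by rewrite pev0 horner0 mpolyC0.
    by rewrite pevD pevM pevX pevC IH hornerMXaddC mpolyCD mpolyCM.
  by rewrite msizeC; case: eqP.
have w0 : w != 0 by apply/negP => /eqP Z; move: sx; rewrite Ex Z pev0 msize0.
have sw : size w = 2%N.
  move: sx; rewrite Ex msize_pev //; move: (size w) (msize _) t1 => [|[|[|x]]] [|[|y]] //= _ [].
  by rewrite mulSn; lia.
exists w`_1, w`_0; split.
  by have := lead_coef_eq0 w; rewrite lead_coefE sw => ->.
rewrite Ex; have Ew' : w = w`_1 *: 'X + (w`_0)%:P.
  apply/polyP => i; rewrite coefD coefZ coefX coefC.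
  case: i => [|[|i]]; rewrite ?mulr0 ?add0r ?mulr1 ?addr0 //.
  by rewrite nth_default // sw.
by rewrite {1}Ew' pevD pevZ pevX pevC.
Qed.

(** The value [C(P)] in [k[x][P]]; unlike in [pev], the coefficients of the univariate polynomial
    lie in [k[x]]. *)
Definition rev (k : fieldType) (C : {poly {poly k}}) (P : {mpoly k[3]}) : {mpoly k[3]} :=
  (map_poly (@rx k) C).[P].

Section Rev.
Variable k : fieldType.
Local Notation B := {mpoly k[3]}.
Implicit Types (C : {poly {poly k}}) (P : B).

Lemma rev0 P : rev 0 P = 0.
Proof. by rewrite /rev map_poly0 horner0. Qed.

Lemma revMXaddC C c P : rev (C * 'X + c%:P) P = rev C P * P + rx c.
Proof.
by rewrite /rev rmorphD rmorphM /= map_polyX map_polyC hornerMXaddC.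
Qed.

Lemma revZ c C P : rev (c *: C) P = rx c * rev C P.
Proof. by rewrite /rev map_polyZ hornerZ. Qed.

Lemma emb_rev (L : fieldType) (toK : {rmorphism {poly k} -> L}) C P :
  emb toK (rev C P) = pev (map_poly toK C) (emb toK P).
Proof.
elim/poly_ind: C => [|C c IH]; first by rewrite rev0 map_poly0 pev0 rmorph0.
rewrite revMXaddC iotaD iotaM IH iota_rx rmorphD rmorphM /= map_polyX map_polyC.
by rewrite pevD pevM pevX pevC.
Qed.

Lemma spec_rev (kap : fieldType) (e : {rmorphism {poly k} -> kap}) C P :
  spec e (rev C P) = pev (map_poly e C) (spec e P).
Proof.
elim/poly_ind: C => [|C c IH]; first by rewrite rev0 map_poly0 pev0 raddf0.
rewrite revMXaddC raddfD /= rmorphM /= IH spec_rx rmorphD rmorphM /= map_polyX map_polyC.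
by rewrite pevD pevM pevX pevC.
Qed.

Lemma derivation_rx (D : B -> B) p : is_derivation D -> D (xB k) = 0 -> D (rx p) = 0.
Proof. by move=> dD Dx; rewrite /rx derivation_pev // Dx mulr0. Qed.

Lemma derivation_rxM (D : B -> B) p f : is_derivation D -> D (xB k) = 0 ->
  D (rx p * f) = rx p * D f.
Proof. by move=> dD Dx; case: (dD) => _ _ DM; rewrite DM derivation_rx // mulr0 addr0. Qed.

Lemma derivation_rev (D : B -> B) C P : is_derivation D -> D (xB k) = 0 -> D P = 0 ->
  D (rev C P) = 0.
Proof.
move=> dD Dx DP; case: (dD) => DD _ DM.
elim/poly_ind: C => [|C c IH]; first by rewrite rev0 derivation0.
by rewrite revMXaddC DD DM IH DP derivation_rx // !mulr0 !addr0.
Qed.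

End Rev.

Lemma size_division_absurd a b g w : (a < b)%N -> (1 < g)%N -> (0 < w)%N -> (0 < a)%N ->
  ((b.-1 * g.-1).+1 + w).-1 = (a.-1 * g.-1).+1 -> False.
Proof.
case: a b g w => [|a] [|b] [|[|g]] [|w] // ab _ _ _ /=; rewrite addnS => -[].
have : (a.+1 * g.+1 <= b * g.+1)%N by rewrite leq_mul2r.
lia.
Qed.

(* Divide [c'] by [c] and compare degrees. *)
Lemma pev_divisor (L : fieldType) n (G s : {mpoly L[n]}) (c c' : {poly L}) :
  (1 < msize G)%N -> c != 0 -> pev c G * s = pev c' G -> exists q, s = pev q G.
Proof.
move=> G1 c0 E; exists (c' %/ c).
have pc0 : pev c G != 0 by rewrite -msize_poly_eq0 msize_pev.
have E' : pev c G * (s - pev (c' %/ c) G) = pev (c' %% c) G.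
  by rewrite mulrBr E {1}(divp_eq c' c) pevD pevM [pev c G * _]mulrC addrC addKr.
suff r0 : c' %% c = 0.
  move/eqP: E'; rewrite r0 pev0 mulf_eq0 (negbTE pc0) /= subr_eq0; exact/eqP.
apply/eqP/negPn/negP => r0.
have w0 : s - pev (c' %/ c) G != 0.
  apply/negP => /eqP Z; move: E'; rewrite Z mulr0 => /esym/(pev_eq0 G1)/eqP.
  by rewrite (negbTE r0).
have := congr1 (fun f => msize f) E'; rewrite /= msizeM // !msize_pev //.
move=> H; apply: (size_division_absurd _ G1 _ _ H).
- by rewrite ltn_modp.
- by rewrite lt0n msize_poly_eq0.
- by rewrite size_poly_gt0.
Qed.

(** * Kernel and local slices of a derivation over the polynomial ring in x *)

Section Plinth.
Variables (k L : fieldType) (toK : {rmorphism {poly k} -> L}).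
Hypothesis toK_inj : injective toK.
Hypothesis toK_frac : forall c : L, exists n d : {poly k}, d != 0 /\ toK d * c = toK n.
Hypothesis char0 : [pchar k] =i pred0.
Local Notation B := {mpoly k[3]}.
Local Notation KYZ := {mpoly L[2]}.
Local Notation iota := (emb toK).
Local Notation dext := (dext toK).

Lemma poly_const (p : {poly k}) : p != 0 -> (size p <= 1)%N ->
  exists2 a, a != 0 & p = a%:P.
Proof.
move=> p0 /size1_polyC E; exists p`_0 => //.
by rewrite -polyC_eq0 -E.
Qed.

Variables (D : B -> B) (F G : KYZ) (c : L).
Hypothesis dD : is_derivation D.
Hypothesis Dx : D (xB k) = 0.
Hypothesis co : coord_system [tuple F; G].
Hypotheses (DF : dext D F = 0) (DG : dext D G = c%:MP) (c0 : c != 0).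

(** [P] is a multiple of [F] plus a scalar, chosen with zero constant term in [y, z] and content
    one. If its reduction modulo [p] were constant it would be zero, and [p] would divide the
    content. *)
Lemma primitive_kernel_generator : exists P : B,
  [/\ D P = 0, coord_system [tuple iota P; G] &
      forall (p : {poly k}) (kap : fieldType) (e : {rmorphism {poly k} -> kap}),
        (1 < size p)%N -> (forall q, e q = 0 -> p %| q) -> (1 < msize (spec e P))%N].
Proof.
have [r [P0 [r0 EP0]]] := clear_denominators toK_frac F.
pose P1 := P0 - rx ((iR P0)@_0%MM).
have iP1 : iota P1 = toK r *: F + (- toK ((iR P0)@_0%MM))%:MP.
  by rewrite /P1 raddfB /= EP0 iota_rx mpolyCN.
have co1 : coord_system [tuple iota P1; G].
  have := coord_system_tri (- toK ((iR P0)@_0%MM)) 0 (_ : toK r != 0) (oner_neq0 L) co.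
  by rewrite triangular2 iP1; apply; rewrite toK_eq0.
have P1n : P1 != 0.
  have [h _] := coord_nonconst co1; apply/negP => /eqP Z.
  by move: h; rewrite Z rmorph0 msize0.
(* The pair [(P1, 0)] is used to extract the content of the single polynomial [P1]. *)
have nz : (P1 != 0) || ((0 : B) != 0) by rewrite P1n.
have [u [P [V' [u0 EP EV prim]]]] := primitive_pair nz.
have V0 : V' = 0.
  by apply/eqP; move/esym/eqP: EV; rewrite mulf_eq0 rx_eq0 (negbTE u0).
have tu0 : toK u != 0 by rewrite toK_eq0.
have EiP : iota P1 = toK u *: iota P by rewrite EP iotaM iota_rx mul_mpolyC.
have DP1 : D P1 = 0.
  apply: (iota_eq0 toK_inj); rewrite -dext_iota // iP1.
  have dE := dext_derivation toK D; case: (dE) => DD DZ _.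
  by rewrite DD DZ DF scaler0 add0r (derivationC _ dE).
exists P; split.
- have : rx u * D P = 0 by rewrite -derivation_rxM // -EP.
  by move/eqP; rewrite mulf_eq0 rx_eq0 (negbTE u0) => /eqP.
- apply: (coord_system_trans co1); apply: I2P; rewrite !(tnth_nth 0) /=.
    by exists (toK u *: 'X_j0); rewrite comp_mpolyZ comp_mpolyXU EiP.
  by exists 'X_j1; rewrite comp_mpolyXU.
move=> p kap e p1 He; rewrite ltnNge; apply/negP => /msize1_polyC sP.
have cP : (iR P)@_0%MM = 0.
  have : (iR P1)@_0%MM = 0.
    by rewrite /P1 raddfB /= iR_rx mcoeffB mcoeffC eqxx mulr1 subrr.
  rewrite EP rmorphM /= iR_rx mul_mpolyC mcoeffZ => /eqP.
  by rewrite mulf_eq0 (negbTE u0) => /eqP.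
have {}sP : spec e P = 0.
  by rewrite sP /spec /= (mcoeff_map_mpoly e) cP raddf0 mpolyC0.
have [P' EP'] := spec_eq0 He sP.
suff : (size p <= 1)%N by rewrite leqNgt p1.
by apply: prim; [exists P' | exists 0; rewrite V0 mulr0].
Qed.

Section Generator.
Variable P : B.
Hypothesis DP : D P = 0.
Hypothesis coP : coord_system [tuple iota P; G].
Hypothesis nonconst : forall (p : {poly k}) (kap : fieldType)
  (e : {rmorphism {poly k} -> kap}),
  (1 < size p)%N -> (forall q, e q = 0 -> p %| q) -> (1 < msize (spec e P))%N.

Lemma dextP : dext D (iota P) = 0.
Proof. by rewrite dext_iota // DP rmorph0. Qed.

(** Over [L] the element [a] is a polynomial in [P], so [r a = C(P)] for a nonzero [r] and some [C]
    over [k[x]]. Modulo an irreducible factor [p] of [r] this reads [C(P) = 0] with [P] nonconstant,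
    so [p] divides [C] and can be cancelled; the induction is on the degree of [r]. *)
Lemma kernel_rev a : D a = 0 -> exists C, a = rev C P.
Proof.
move=> Da; have charL := pchar_emb toK_inj char0.
have Ea : dext D (iota a) = 0 by rewrite dext_iota // Da rmorph0.
have [g Hg] := plane_kernel charL coP (dext_derivation toK D) dextP DG c0 Ea.
have [r [C [r0 EC]]] := clear_denominators_poly toK_frac g.
have {Hg EC Ea} E : rx r * a = rev C P.
  apply: (iota_inj toK_inj); rewrite iotaM iota_rx emb_rev EC pevZ -Hg.
  exact: mul_mpolyC.
have [n] := ubnP (size r); elim: n r C r0 E => // n IH r C r0 E hn.
case: (leqP (size r) 1) => [/(poly_const r0) [b b0 Er]|r1].
  exists (b^-1%:P *: C); rewrite revZ -E Er mulrA -rmorphM -polyCM mulVf //.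
  by rewrite rmorph1 mul1r.
have [p [ip /dvdpP [r' Er]]] := irreducible_factor r1.
have [kap [e [ep He _]]] := residue_field ip.
have p1 := ip.1; have p0 : p != 0 by rewrite -size_poly_gt0 ltnW.
have r'0 : r' != 0 by apply/negP => /eqP Z; rewrite Er Z mul0r eqxx in r0.
have := congr1 (spec e) E; rewrite rmorphM /= spec_rx Er rmorphM ep mulr0 mpolyC0 mul0r.
rewrite spec_rev => /esym /(pev_eq0 (nonconst p1 He)) C0.
pose C' := map_poly (fun q => q %/ p) C.
have EC' : C = p *: C'.
  apply/polyP => i; rewrite coefZ coef_map_id0 ?div0p // mulrC divpK //.
  by apply: He; have := congr1 (fun q : {poly _} => q`_i) C0; rewrite coef_map coef0.
apply: (IH r' C').
- exact: r'0.
- have rp0 : rx p != 0 by rewrite rx_eq0.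
  apply: (mulfI rp0); rewrite -revZ -EC' -E Er mulrA -rmorphM; congr (rx _ * _).
  by rewrite mulrC.
- by move: hn; rewrite Er size_mul //; move: (size r') (size p) p1 => x [|[|y]] // _; lia.
Qed.

(** A slice [s] makes the ring a polynomial ring in [s] over the kernel, so [(s, P, x)] is a
    coordinate system, and [D] kills its last two members. *)
Lemma slice_rank_le1 s (a : k) : locally_nilpotent D -> a != 0 -> D s = a%:MP ->
  rank_le D 1.
Proof.
move=> nD a0 Ds; pose t : 3.-tuple B := [tuple s; P; xB k]; exists t.
have cr C : exists r, rev C P = comp_mpoly t r.
  elim/poly_ind: C => [|C q [r Hr]]; first by exists 0; rewrite rev0 comp_mpoly0.
  exists (r * 'X_i1 + pev q 'X_i2); rewrite revMXaddC Hr rmorphD rmorphM /= comp_pev.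
  by rewrite !comp_mpolyXU.
split; last first.
  by move=> f; apply: subalg_kernel => //; apply: I3P; rewrite ?inE //= !(tnth_nth 0).
(* Induction on the order of nilpotency: [D b] is a polynomial in [s, P, x]; integrating it along
   [s] gives [R] with [D(R(t)) = D b], and the difference is in the kernel. *)
move=> b; have [n Hn] := nD b; elim: n b Hn => [|n IH] b.
  by move=> /= ->; exists 0; rewrite comp_mpoly0.
rewrite iterSr => /IH [r Hr].
have [R HR] := mpoly_antideriv char0 i0 (a^-1 *: r).
have DR : D (comp_mpoly t R) = D b.
  rewrite derivation_comp // big_I3 !(tnth_nth 0) /= DP Dx !mulr0 !addr0 Ds HR Hr.
  by rewrite comp_mpolyZ mulrC mul_mpolyC scalerA mulfV // scale1r.
have [C HC] : exists C, b - comp_mpoly t R = rev C P.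
  by apply: kernel_rev; rewrite derivationB // DR subrr.
have [r' Hr'] := cr C; exists (r' + R).
by rewrite rmorphD /= -Hr' -HC subrK.
Qed.

Lemma lift_poly (kap : fieldType) (e : {rmorphism {poly k} -> kap}) (q : {poly kap}) :
  (forall z, exists r, e r = z) -> exists Q, map_poly e Q = q.
Proof.
move=> se; elim/poly_ind: q => [|q z [Q HQ]]; first by exists 0; rewrite map_poly0.
have [r Hr] := se z; exists (Q * 'X + r%:P).
by rewrite -Hr -HQ rmorphD rmorphM /= map_polyX map_polyC.
Qed.

(* [p] is an irreducible factor of an [f] of minimal degree such that [f(x)] is in the
   image of [D]; modulo [p], a local slice [s] with [D s = f(x)] would otherwise be a
   polynomial in [P], contradicting minimality. *)
Lemma plinth_divisor : locally_nilpotent D -> ~ rank_le D 1 ->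
  exists2 p : {poly k}, (1 < size p)%N &
    forall a s', D s' = a -> D a = 0 -> exists a', a = rx p * a'.
Proof.
move=> nD nrank; have charL := pchar_emb toK_inj char0.
have [f [s [f0 Ds fmin]]] : exists (f : {poly k}) (s : B), [/\ f != 0, D s = rx f &
    forall g u, g != 0 -> D u = rx g -> (size f <= size g)%N].
  have [f [s [f0 Ds]]] : exists (f : {poly k}) (s : B), f != 0 /\ D s = rx f.
    have [r [b [r0 Eb]]] := clear_denominators toK_frac G.
    have EDb : iota (D b) = (toK r * c)%:MP.
      case: (dext_derivation toK D) => _ DZ _.
      by rewrite -dext_iota // Eb DZ DG -mul_mpolyC -mpolyCM.
    have [f Ef] := iota_const toK_inj EDb; exists f, b; split=> //.
    apply/negP => /eqP Z; move: EDb; rewrite Ef Z !rmorph0 => /esym/eqP.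
    by rewrite mpolyC_eq0 mulf_eq0 toK_eq0 // (negbTE r0) (negbTE c0).
  have [n] := ubnP (size f); elim: n f s f0 Ds => // n IH f s f0 Ds hn.
  have [[g [u [g0 Du lt]]]|H] := classic (exists (g : {poly k}) (u : B),
      [/\ g != 0, D u = rx g & (size g < size f)%N]).
    by apply: (IH g u) => //; apply: leq_trans lt _.
  exists f, s; split=> // g u g0 Du; rewrite leqNgt; apply/negP => lt.
  by apply: H; exists g, u.
case: (leqP (size f) 1) => [/(poly_const f0) [a a0 Ef]|f1].
  by case: nrank; apply: (slice_rank_le1 nD a0 (s := s)); rewrite Ds Ef rxC.
have [p [ip /dvdpP [f' Ef]]] := irreducible_factor f1.
have [kap [e [ep He se]]] := residue_field ip.
have p1 := ip.1; have p0 : p != 0 by rewrite -size_poly_gt0 ltnW.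
have Pn := nonconst p1 He.
exists p => // a s' Ds' Da; apply: (spec_eq0 He).
have [C EC] := kernel_rev Da.
(* [D s = f(x)] and [D s' = a] both lie in the kernel, so [a s - f(x) s'] does too. As [p] divides
   [f], reduction modulo [p] leaves [C(P) s = C'(P)]. *)
have [C' EC'] : exists C', a * s - rx f * s' = rev C' P.
  apply: kernel_rev; case: (dD) => _ _ DM.
  by rewrite derivationB // derivation_rxM // DM Ds Ds' Da mulr0 addr0 mulrC subrr.
rewrite EC spec_rev; case: (eqVneq (map_poly e C) 0) => [->|C0]; first exact: pev0.
have Es : pev (map_poly e C) (spec e P) * spec e s = pev (map_poly e C') (spec e P).
  rewrite -!spec_rev -EC -EC' raddfB /= !rmorphM /= spec_rx Ef rmorphM ep mulr0.
  by rewrite mpolyC0 mul0r subr0.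
have [q Hq] := pev_divisor Pn C0 Es.
have [Q HQ] := lift_poly q se.
(* If [C] does not vanish modulo [p], then [s] is congruent to some [Q(P)], and the quotient of
   [s - Q(P)] by [p] is a local slice with value [f / p]. *)
have [s1 Es1] : exists s1, s - rev Q P = rx p * s1.
  by apply: (spec_eq0 He); rewrite raddfB /= spec_rev HQ Hq subrr.
have Ds1 : D s1 = rx f'.
  have rp0 : rx p != 0 by rewrite rx_eq0.
  apply: (mulfI rp0); rewrite -derivation_rxM // -Es1 derivationB // derivation_rev //.
  by rewrite subr0 Ds Ef mulrC rmorphM.
have f'0 : f' != 0 by apply/negP => /eqP Z; rewrite Ef Z mul0r eqxx in f0.
have := fmin _ _ f'0 Ds1; rewrite Ef size_mul //.
by move: (size f') (size p) p1 => x [|[|y]] // _; lia.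
Qed.

End Generator.

Lemma plinth_variable (t : 3.-tuple B) b (q : {poly k}) :
  locally_nilpotent D -> ~ rank_le D 1 -> coord_system t -> D (tnth t i2) = 0 ->
  q != 0 -> D b = pev q (tnth t i2) ->
  exists u v, u != 0 /\ xB k = u *: tnth t i2 + v%:MP.
Proof.
move=> nD nrank ct Dt q0 Db.
have [P [DP coP Pn]] := primitive_kernel_generator.
have [p p1 Hp] := plinth_divisor DP coP Pn nD nrank.
have Da : D (pev q (tnth t i2)) = 0 by rewrite derivation_pev // Dt mulr0.
have [a' Ea] := Hp _ _ Db Da.
exact: (variable_of_divisor char0 ct q0 p1 Ea).
Qed.

End Plinth.

(** * Chains and complexity *)

Lemma rank_le1_partial (k : fieldType) (D : {mpoly k[3]} -> {mpoly k[3]}) (t : 3.-tuple {mpoly k[3]}) :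
  coord_system t -> is_partial t i0 D -> rank_le D 1.
Proof.
move=> ct [dD HD]; exists t; split=> // f; apply: subalg_kernel => //.
by apply: I3P; rewrite ?inE // HD.
Qed.

Section ChainBounds.
Variables (k L : fieldType) (toK : {rmorphism {poly k} -> L}).
Hypothesis toK_inj : injective toK.
Hypothesis toK_frac : forall c : L, exists n d : {poly k}, d != 0 /\ toK d * c = toK n.
Hypothesis char0 : [pchar k] =i pred0.
Local Notation B := {mpoly k[3]}.
Local Notation KYZ := {mpoly L[2]}.
Local Notation iota := (emb toK).
Local Notation dext := (dext toK).
Local Notation witness := (witness toK).

Lemma emb_pev_const p (w f : B) c : iota w = c%:MP -> f = pev p w -> f != 0 ->
  exists2 a : L, a != 0 & iota f = a%:MP.
Proof.
move=> Ew -> nz.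
suff [a Ea] : exists a, iota (pev p w) = a%:MP.
  exists a => //; apply/negP => /eqP Z; case/negP: nz; apply/eqP.
  by apply: (iota_eq0 toK_inj); rewrite Ea Z mpolyC0.
elim/poly_ind: p {nz} => [|p b [a Ea]]; first by exists 0; rewrite pev0 rmorph0 mpolyC0.
exists (a * c + toK b%:P).
by rewrite pevD pevM pevX pevC iotaD iotaM Ea Ew iotaC mpolyCD mpolyCM.
Qed.

Lemma coord_system_XX : coord_system [tuple 'X_j0; 'X_j1 : KYZ].
Proof.
move=> f; exists f; rewrite -[LHS]comp_mpoly_id; congr comp_mpoly.
by apply: eq_from_tnth; apply: I2P; rewrite tnth_mktuple !(tnth_nth 0).
Qed.

(** Only derivations killing [x] are considered here, so that the result serves both the given chain
    and its transport by an automorphism. As the third coordinate is a scalar of [L], so are the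
    coefficients [f] and [h]. *)
Lemma chain_to_plane (T : 3.-tuple B) (ds : nat -> B -> B) n cT :
  coord_system T -> iota (tnth T i2) = cT%:MP ->
  witness 0 (iota (tnth T i0)) (iota (tnth T i1)) ->
  (forall i, (1 <= i <= n.+2)%N -> is_derivation (ds i) /\ ds i (xB k) = 0) ->
  is_partial T i0 (ds 1%N) -> is_partial T i1 (ds 2%N) ->
  (forall i, (3 <= i <= n.+2)%N -> exists (s f h : B),
    [/\ ds i.-1 s = 0, (exists p, f = pev p (tnth T i2)) /\ f != 0,
        (exists p, h = pev p (tnth T i2)) /\ h != 0 &
        forall g, h * ds i g = s * ds i.-1 g + f * ds i.-2 g]) ->
  exists F G c, [/\ coord_system [tuple F; G], witness n F G, c != 0,
    dext (ds n.+2) F = 0 & dext (ds n.+2) G = c%:MP].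
Proof.
move=> cT' Ec W H P1 P2 rel; have charL := pchar_emb toK_inj char0.
have [d1 x1] := H 1%N isT; have [d2 x2] := H 2%N isT.
have cT2 := coord_system_iota cT' Ec.
have E1 i : dext (ds 1%N) (iota (tnth T i)) = iota (i == i0)%:R.
  by rewrite dext_iota //; case: P1 => _ ->.
have E2 i : dext (ds 2%N) (iota (tnth T i)) = iota (i == i1)%:R.
  by rewrite dext_iota //; case: P2 => _ ->.
have [||||i hi|F [G [c [c' [[coFG WF c0 _] [EF EG _ _]]]]]] :=
  @chain_analysis k L toK charL (fun i => dext (ds i)) n.+2 _ _ cT2 W
    (fun i => dext_derivation toK (ds i)) _ _ _ _ _ n (leqnn _).
- by rewrite E1 rmorph0.
- by rewrite E1 rmorph1.
- by rewrite E2 rmorph0.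
- by rewrite E2 rmorph1.
- have [s [f [h [Es [[p Ef] f0] [[q Eh] h0] R]]]] := rel i hi.
  have [a a0 Ea] := emb_pev_const Ec Ef f0.
  have [b b0 Eb] := emb_pev_const Ec Eh h0.
  case/andP: hi => i3 il.
  have hyp j : (1 <= j)%N -> (j <= i)%N -> is_derivation (ds j) /\ ds j (xB k) = 0.
    by move=> j1 ji; apply: H; rewrite j1 (leq_trans ji il).
  have [dA xA] := hyp i (ltnW (ltnW i3)) (leqnn i).
  have [dB xB'] : is_derivation (ds i.-1) /\ ds i.-1 (xB k) = 0.
    by apply: hyp; [case: (i) i3 => [|[|]] | apply: leq_pred].
  have [dC xC] : is_derivation (ds i.-2) /\ ds i.-2 (xB k) = 0.
    apply: hyp; [by case: (i) i3 => [|[|[|]]] |].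
    exact: leq_trans (leq_pred _) (leq_pred _).
  exists (iota s), a, b; split=> //; first by rewrite dext_iota // Es rmorph0.
  have key g : b *: dext (ds i) (iota g) =
      iota s * dext (ds i.-1) (iota g) + a *: dext (ds i.-2) (iota g).
    by rewrite !dext_iota // -!mul_mpolyC -Ea -Eb -!iotaM -iotaD R.
  (* The scalar [a] is absorbed into the derivation that it multiplies; a relation of derivations of
     the plane then has to be checked on [y] and [z] only. *)
  move=> g; have Z : is_derivation (fun g => a *: dext (ds i.-2) g).
    case: (dext_derivation toK (ds i.-2)) => A1 A2 A3; split=> [u v|u v|u v].
    - by rewrite A1 scalerDr.
    - by rewrite A2 !scalerA mulrC.
    - by rewrite A3 scalerDr !scalerAr.
  apply: (derivation_pair_relation coord_system_XX Z (dext_derivation _ _) (dext_derivation _ _)).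
    by rewrite -(iota_y toK).
  by rewrite -(iota_z toK).
by exists F, G, c; split.
Qed.

Lemma witness_of_chain D (t : 3.-tuple B) ds n u v :
  coord_system t -> full_irr_MC_chain D t ds n.+2 ->
  u != 0 -> xB k = u *: tnth t i2 + v%:MP ->
  exists F G c, [/\ coord_system [tuple F; G], witness n F G, c != 0,
    dext D F = 0 & dext D G = c%:MP].
Proof.
move=> ct [[_ P1 /(_ isT) P2 Eds all] rel] u0 Ex.
have Et : tnth t i2 = u^-1 *: (xB k - v%:MP).
  by rewrite Ex addrK scalerA mulVf // scale1r.
have Ec : iota (tnth t i2) = (toK (u^-1%:P) * (toK 'X - toK v%:P))%:MP.
  by rewrite Et iotaZ raddfB /= iota_x iotaC -mpolyCB -mul_mpolyC -mpolyCM.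
have W : witness 0 (iota (tnth t i0)) (iota (tnth t i1)).
  apply: witness_good; exists (tnth t i0), (tnth t i1); split=> //.
  apply: (coord_system_trans ct); apply: I3P.
  - by exists 'X_i1; rewrite comp_mpolyXU.
  - by exists 'X_i2; rewrite comp_mpolyXU.
  - exists (u^-1 *: ('X_i0 - v%:MP)).
    by rewrite comp_mpolyZ rmorphB /= comp_mpolyXU comp_mpolyC Et.
have [||||F [G [c [coFG WF c0 EF EG]]]] := chain_to_plane (n := n) (ds := ds) ct Ec W.
- move=> i hi; have [[di _] _ ti] := all i hi; split=> //.
  by case: (di) => DD DZ _; rewrite Ex DD DZ ti scaler0 derivationC // addr0.
- exact: P1.
- exact: P2.
- move=> i hi; have [s [f [h [Es [/subalg1P Sf f0] [/subalg1P Sh h0] R]]]] := rel i hi.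
  by exists s, f, h; split.
have E g : dext (ds n.+2) g = dext D g by apply: dext_eq.
by exists F, G, c; rewrite -!E.
Qed.

(** At this stage [y_3] is not yet related to [x]. The automorphism sending [x, y, z] to
    [y_3, y_1, y_2] transports the chain to one over [k[x]] starting with the partial derivatives
    along [y] and [z]. The plane calculus gives a local slice with value in [k[x]], which is carried
    back to one with value in [k[y_3]]. *)
Lemma chain_local_slice D (t : 3.-tuple B) ds n :
  coord_system t -> full_irr_MC_chain D t ds n.+2 ->
  exists b q, q != 0 /\ D b = pev q (tnth t i2).
Proof.
move=> ct [[_ P1 /(_ isT) P2 Eds all] rel].
pose t' : 3.-tuple B := [tuple tnth t i2; tnth t i0; tnth t i1].
have ct' : coord_system t'.
  apply: (coord_system_trans ct); apply: I3P.
  - by exists 'X_i1; rewrite comp_mpolyXU.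
  - by exists 'X_i2; rewrite comp_mpolyXU.
  - by exists 'X_i0; rewrite comp_mpolyXU.
have [s [tK sK]] := coord_system_inverse char0 ct'.
have phx : comp_mpoly t' (xB k) = tnth t i2 by rewrite comp_mpolyXU.
have phy : comp_mpoly t' (yB k) = tnth t i0 by rewrite comp_mpolyXU.
have phz : comp_mpoly t' (zB k) = tnth t i1 by rewrite comp_mpolyXU.
pose ds' i f := comp_mpoly s (ds i (comp_mpoly t' f)).
pose T : 3.-tuple B := [tuple yB k; zB k; xB k].
have cT : coord_system T.
  apply: (coord_system_trans (@coord_systemX k)); apply: I3P.
  - by exists 'X_i2; rewrite comp_mpolyXU.
  - by exists 'X_i0; rewrite comp_mpolyXU.
  - by exists 'X_i1; rewrite comp_mpolyXU.
have der i : is_derivation (ds i) -> is_derivation (ds' i).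
  move=> [DD DZ DM]; split=> [f g|c f|f g]; rewrite /ds'.
  - by rewrite rmorphD DD rmorphD.
  - by rewrite comp_mpolyZ DZ comp_mpolyZ.
  - by rewrite [comp_mpoly t' _]rmorphM DM [LHS]rmorphD /= ![comp_mpoly s (_ * _)]rmorphM /= !tK.
have sub f : subalg t (pred1 i2) f -> exists p, comp_mpoly s f = pev p (tnth T i2).
  by case/subalg1P => p ->; exists p; rewrite comp_pev -phx tK.
have inj0 f : f != 0 -> comp_mpoly s f != 0.
  by apply: contra => /eqP Z; rewrite -(sK f) Z comp_mpoly0.
have W : witness 0 (iota (tnth T i0)) (iota (tnth T i1)).
  by have := witness_yz toK; rewrite -(iota_y toK) -(iota_z toK).
have [||||F [G [c [coFG WF c0 EF EG]]]] :=
  chain_to_plane (n := n) (ds := ds') cT (iota_x toK) W.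
- move=> i hi; have [[di _] _ ti] := all i hi; split; first exact: der.
  by rewrite /ds' phx ti comp_mpoly0.
- case: P1 => d1 H1; split; first exact: der.
  by apply: I3P; rewrite /ds' !(tnth_nth 0) /= ?phx ?phy ?phz H1 rmorph_nat.
- case: P2 => d1 H1; split; first exact: der.
  by apply: I3P; rewrite /ds' !(tnth_nth 0) /= ?phx ?phy ?phz H1 rmorph_nat.
- move=> i hi; have [s' [f [h [Es [Sf f0] [Sh h0] R]]]] := rel i hi.
  exists (comp_mpoly s s'), (comp_mpoly s f), (comp_mpoly s h); split.
  + by rewrite /ds' sK Es comp_mpoly0.
  + by split; [exact: sub | exact: inj0].
  + by split; [exact: sub | exact: inj0].
  + by move=> g; rewrite /ds' -!rmorphM /= R rmorphD.
have [[dl _] _ tl] := all n.+2 (leqnn n.+2).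
have dl' := der _ dl.
have xl : ds' n.+2 (xB k) = 0 by rewrite /ds' phx tl comp_mpoly0.
have [r [b [r0 Eb]]] := clear_denominators toK_frac G.
have EDb : iota (ds' n.+2 b) = (toK r * c)%:MP.
  have dE := dext_derivation toK (ds' n.+2); case: (dE) => _ DZ _.
  by rewrite -dext_iota // Eb DZ EG -mul_mpolyC -mpolyCM.
have [q Eq] := iota_const toK_inj EDb; exists (comp_mpoly t' b), q; split.
  apply/negP => /eqP Z; move: EDb; rewrite Eq Z !rmorph0 => /esym/eqP.
  by rewrite mpolyC_eq0 mulf_eq0 toK_eq0 // (negbTE r0) (negbTE c0).
by rewrite -Eds -[LHS]sK -/(ds' n.+2 b) Eq /rx comp_pev phx.
Qed.

Section Main.
Variables (D : B -> B) (F0 G0 : KYZ) (c0 : L).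
Hypotheses (LD : is_LND D) (irD : irreducible_der D) (nrank : ~ rank_le D 1).
Hypothesis Dx : D (xB k) = 0.
Hypothesis co : coord_system [tuple F0; G0].
Hypotheses (DF : dext D F0 = 0) (DG : dext D G0 = c0%:MP) (c00 : c0 != 0).

Lemma ulev_of_witness m : witness m F0 G0 -> ulev_chain D m.+2.
Proof.
move=> W; have [t [ds [_ [_ [[ct tx ch] _]]]]] :=
  chain_of_witness toK_inj toK_frac co W LD irD Dx DF DG c00.
by exists t; split=> //; [rewrite tx | exists ds].
Qed.

Lemma witness_of_ulev l : ulev_chain D l -> exists2 n, l = n.+2 & witness n F0 G0.
Proof.
case: LD => dD nD [t [ct Dt [ds ch]]].
case: l ch => [|[|n]] ch; first by case: ch => [[]].
  (* A chain of length one would make [D] a partial derivative, of rank at most one. *)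
  case: nrank; case: ch => [[_ [d1 H1] _ Eds _] _].
  apply: (rank_le1_partial ct); split=> // i; by rewrite -Eds.
exists n => //; have [b [q [q0 Db]]] := chain_local_slice ct ch.
have [u [v [u0 Ex]]] := plinth_variable toK_inj toK_frac char0 dD Dx co DF DG c00
  nD nrank ct Dt q0 Db.
have [F [G [c [coFG W cn0 EF EG]]]] := witness_of_chain ct ch u0 Ex.
have [a [b' [e [p [a0 e0 EF' EG']]]]] :=
  plane_slices (pchar_emb toK_inj char0) co coFG (dext_derivation toK D) DF EF DG EG c00 cn0.
by apply: (witness_tri a0 e0 (b := b') (p := p)); rewrite -EF' -EG'.
Qed.

Lemma exists_complexity_ulev : exists m,
  [/\ witness m F0 G0, forall m', (m' < m)%N -> ~ witness m' F0 G0 & has_ulev D (m + 2)].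
Proof.
have [m0 W0] := witness_exists toK (pchar_emb toK_inj char0) co.
have [m [W Wmin]] : exists m, witness m F0 G0 /\ forall m', (m' < m)%N -> ~ witness m' F0 G0.
  have [n] := ubnP m0; elim: n m0 W0 => // n IH m0 W0 hn.
  have [[m' lt W']|H] := classic (exists2 m', (m' < m0)%N & witness m' F0 G0).
    by apply: (IH m') => //; apply: leq_trans lt _.
  by exists m0; split=> // m' lt W'; apply: H; exists m'.
exists m; split=> //; rewrite addn2; split; first exact: ulev_of_witness.
move=> l lt /witness_of_ulev [n El Wn]; apply: (Wmin n) => //.
by rewrite El !ltnS in lt.
Qed.

End Main.
End ChainBounds.

(** * Agreement of the recursive complexity with compositions of automorphisms *)

Section Compositions.
Variables (k L : fieldType) (toK : {rmorphism {poly k} -> L}).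
Local Notation B := {mpoly k[3]}.
Local Notation KYZ := {mpoly L[2]}.
Local Notation aut := (2.-tuple KYZ).
Implicit Types (F G : KYZ) (tau : aut).

(* Copies of the definitions of the statement over an abstract field [L], where
   computations do not unfold the construction of fractions. *)
Definition compose (beta alpha : aut) : aut :=
  [tuple comp_mpoly alpha (tnth beta j0); comp_mpoly alpha (tnth beta j1)].

Definition swap : aut := [tuple 'X_j1; 'X_j0].

Definition triangular (a b c : L) (p : {poly L}) : aut :=
  [tuple a *: 'X_j0 + b%:MP; c *: 'X_j1 + pev p 'X_j0].

Definition is_triangular tau := exists (a b c : L) (p : {poly L}),
  [/\ a != 0, c != 0 & tau = triangular a b c p].

Definition composite alpha tau0 (rest : seq aut) : aut :=
  foldl (fun acc tau => compose tau (compose swap acc)) (compose tau0 alpha) rest.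

Definition good_pair (phi : aut) := exists f g : B,
  [/\ tnth phi j0 = emb toK f, tnth phi j1 = emb toK g & coord_system [tuple xB k; f; g]].

Definition complexity_le alpha m := exists tau0 (rest : seq aut),
  [/\ size rest = m, is_triangular tau0, (forall tau, tau \in rest -> is_triangular tau)
    & good_pair (composite alpha tau0 rest)].

Lemma compose_swap F G : compose swap [tuple F; G] = [tuple G; F].
Proof.
by apply: eq_from_tnth; apply: I2P; rewrite !(tnth_nth 0) /= comp_mpolyXU.
Qed.

Lemma compose_triangular a b c p F G : compose (triangular a b c p) [tuple F; G] =
  [tuple a *: F + b%:MP; c *: G + pev p F].
Proof.
apply: eq_from_tnth; apply: I2P; rewrite !(tnth_nth 0) /= rmorphD /= comp_mpolyZ.
  by rewrite comp_mpolyC comp_mpolyXU.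
by rewrite comp_pev !comp_mpolyXU.
Qed.

(** Both sides peel the same end: [tau_0] and the first swap act on the pair, and the remaining
    factors decompose the result. *)
Lemma complexity_leP m F G : complexity_le [tuple F; G] m <-> witness toK m F G.
Proof.
elim: m F G => [|m IH] F G; split.
- move=> [tau0 [rest [sz [a [b [c [p [a0 c0 E0]]]]] _ good]]].
  case: rest sz good => // _; rewrite E0 /composite /= compose_triangular => good.
  have [f [g [Ef Eg cfg]]] := good.
  by exists a, b, c, p; split=> //; exists f, g; split.
- move=> [a [b [c [p [a0 c0 [f [g [Ef Eg cfg]]]]]]]].
  exists (triangular a b c p), [::]; split=> //; first by exists a, b, c, p.
  by rewrite /composite /= compose_triangular; exists f, g.
- move=> [tau0 [rest [sz [a [b [c [p [a0 c0 E0]]]]] Hr good]]].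
  case: rest sz Hr good => [|tau rest] //= [sz] Hr; rewrite E0 => good.
  exists a, b, c, p; split=> //; apply/IH; exists tau, rest; split=> //.
  + by apply: Hr; rewrite inE eqxx.
  + by move=> tau' H; apply: Hr; rewrite inE H orbT.
  + by move: good; rewrite /composite /= compose_triangular compose_swap.
- move=> [a [b [c [p [a0 c0 /IH [tau [rest [sz Ht Hr good]]]]]]]].
  exists (triangular a b c p), (tau :: rest); split.
  + by rewrite /= sz.
  + by exists a, b, c, p.
  + by move=> tau'; rewrite inE => /predU1P [->|/Hr].
  + by rewrite /composite /= compose_triangular compose_swap.
Qed.

End Compositions.

Lemma fraction_quotient (k : fieldType) (c : K k) : exists n d : {poly k},
  d != 0 /\ FracField.tofrac d * c = FracField.tofrac n.
Proof.
elim/quotW: c => x; exists x.1, x.2; split; first exact: denom_ratioP.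
unlock FracField.tofrac; rewrite -[LHS]FracField.pi_mul; apply/eqmodP.
rewrite /= /FracField.equivf /FracField.mulf !numden_Ratio ?oner_eq0 ?mul1r ?mulr1 //.
all: exact: denom_ratioP.
Qed.

Lemma tofrac_inj (R : idomainType) : injective (@FracField.tofrac R).
Proof. by move=> p q /eqP; rewrite tofrac_eq => /eqP. Qed.

Section Fractions.
Variable k : fieldType.
Local Notation toK := (@FracField.tofrac {poly k} : {rmorphism {poly k} -> K k}).

(** With [L] the fraction field of [k[x]], the abstract copies are convertible to the definitions of
    the statement. *)
Lemma complexity_le_iota (alpha : aut2 k) m :
  complexity_le toK alpha m <-> complexity_le_witness alpha m.
Proof. by []. Qed.

Lemma extends_dext (D : {mpoly k[3]} -> {mpoly k[3]}) Dt : is_derivation D ->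
  D (xB k) = 0 -> extends D Dt -> Dt =1 dext toK D.
Proof.
move=> dD Dx [dDt H]; apply: derivation_ext => //; first exact: dext_derivation.
apply: I2P.
  by rewrite (dext_y toK D) -(iota_y toK); exact: H.
by rewrite (dext_z toK D) -(iota_z toK); exact: H.
Qed.

End Fractions.

Theorem theorem4p9 (k : fieldType) (D : {mpoly k[3]} -> {mpoly k[3]})
    (Dt : {mpoly (K k)[2]} -> {mpoly (K k)[2]}) (alpha : aut2 k) :
  [pchar k] =i pred0 ->
  is_LND D -> irreducible_der D -> has_rank D 2 -> D (xB k) = 0 ->
  extends D Dt ->
  in_Psi Dt alpha ->
  exists m : nat, has_complexity alpha m /\ has_ulev D (m + 2).
Proof.
move=> char0 LD irD [_ rk] Dx ext [co ker [c [c0 DG]]].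
have EDt := extends_dext (proj1 LD) Dx ext.
pose toK : {rmorphism {poly k} -> K k} := @FracField.tofrac {poly k}.
have DF : dext toK D (tnth alpha j0) = 0.
  rewrite -EDt; apply/ker; apply/subalg1P; exists 'X; exact/esym/pevX.
rewrite EDt in DG; rewrite (tuple2_eta alpha) in co.
have [m [W Wmin ul]] := exists_complexity_ulev (@tofrac_inj _) (@fraction_quotient k)
  char0 LD irD (rk 1%N isT) Dx co DF DG c0.
have P n : complexity_le_witness alpha n <-> witness toK n (tnth alpha j0) (tnth alpha j1).
  by rewrite -complexity_leP -tuple2_eta; exact: complexity_le_iota.
exists m; split=> //; split; first exact/P.
by move=> m' lt /P; apply: Wmin.
Qed.
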